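(* A process $X$ is a quasi-potential (resp. an integrable quasi-martingale) if and only if it decomposes into the difference $$X=X'-X''$$ of two potentials (resp. positive, integrable supermartingales) such that $\|X\|_{\mathcal Q}=\|X'\|_{\mathcal Q}+\|X''\|_{\mathcal Q}$. Any other decomposition $Y'-Y''$ of $X$ as the difference of two potentials (resp. positive, integrable supermartingales) is such that $Y'-X'$ and $Y''-X''$ are potentials (resp. positive, integrable supermartingales).
   Context: Setting. $(\Omega,\mathscr F,P)$ is a standard probability space, $P(\cdot)$ also denotes expectation and $P(\cdot|\mathscr G)$ conditional expectation. $\Delta$ is a linearly ordered set and $(\mathscr F_\delta:\delta\in\Delta)$ an increasing family of sub $\sigma$-algebras of $\mathscr F$ (no right continuity assumed); all $\sigma$-algebras include the corresponding $P$-null sets. All processes $X=(X_\delta:\delta\in\Delta)$ are adapted ($X_\delta$ is $\mathscr F_\delta$-measurable for each $\delta\in\Delta$), and no right continuity is assumed. Two processes $X,Y$ are considered equal (up to modification) if $P(X_\delta=Y_\delta)=1$ for all $\delta\in\Delta$. A process $X$ is integrable if $\sup_{\delta\in\Delta}P(|X_\delta|)<\infty$. $\mathscr D$ is the collection of finite subsets $d=\{\delta_1\le\ldots\le\delta_{N+1}\}$ of $\Delta$. The $d$-variation of $X$ is $V^d(X)=\sum_{n=1}^N|X_{\delta_n}-P(X_{\delta_{n+1}}|\mathscr F_{\delta_n})|$. $X$ is a quasi-martingale if $\|X\|_{\mathcal Q}=\sup\{P(V^d(X)):d\in\mathscr D\}<\infty$ (integrability of $X$ is not part of the definition). A quasi-potential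 is a quasi-martingale $X$ for which there is a sequence $(\delta_n)_{n\in\mathbb N}$ in $\Delta$ such that $\lim_nP(|X_{\bar\delta_n}|)=0$ for every sequence $(\bar\delta_n)_{n\in\mathbb N}$ in $\Delta$ with $\bar\delta_n\ge\delta_n$ for all $n$. A potential is a process that is both a quasi-potential and a positive supermartingale. *)

(* Defs.v *)
From HB Require Import structures.
From mathcomp Require Import all_boot all_order all_algebra.
From mathcomp Require Import all_classical all_reals all_analysis.
Import Order.TTheory GRing.Theory Num.Theory.
Import numFieldNormedType.Exports.

Set Implicit Arguments.
Unset Strict Implicit.
Unset Printing Implicit Defensive.

Local Open Scope classical_set_scope.
Local Open Scope ring_scope.

(* A sub-sigma-algebra of T is a [G : set (set T)] with [sigma_algebra setT G];
   the measurable sets of [g_sigma_algebraType G] are then exactly those of G. *)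
Definition measurable_wrt {R : realType} {T : pointedType} (G : set (set T))
    (f : T -> R) : Prop :=
  measurable_fun [set: g_sigma_algebraType G] (f : g_sigma_algebraType G -> R).

Section conditional_expectation.
Context {dT : measure_display} {T : measurableType dT} {R : realType}.
Context (P : probability T R).

Definition in_L1 (f : T -> R) : Prop := P.-integrable setT (EFin \o f).

Definition is_condexp (G : set (set T)) (f g : T -> R) : Prop :=
  [/\ measurable_wrt G g, in_L1 g &
      forall A, G A -> (\int[P]_(w in A) (g w)%:E = \int[P]_(w in A) (f w)%:E)%E].

(* A chosen version of P(f | G). The default value is not reached when f is in
   L^1, the only case in which it is used below. *)
Definition condexp (G : set (set T)) (f : T -> R) : T -> R :=
  xget (cst 0) [set g | is_condexp G f g].

End conditional_expectation.

Section processes.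
Context {dT : measure_display} {T : measurableType dT} {R : realType}.
Context (P : probability T R).
Context {dD : Order.disp_t} {Delta : orderType dD}.
Context (F : Delta -> set (set T)).
Implicit Types (X Y : Delta -> T -> R) (d : seq Delta).

Definition filtration : Prop :=
  [/\ forall t, sigma_algebra setT (F t),
      forall t, F t `<=` measurable,
      forall s t, (s <= t)%O -> F s `<=` F t &
      forall t, P.-negligible `<=` F t].

Definition adapted X : Prop := forall t, measurable_wrt (F t) (X t).

Definition same_process X Y : Prop :=
  forall t, {ae P, forall w, X t w = Y t w}.

Definition diff_process X Y : Delta -> T -> R := fun t w => X t w - Y t w.

Definition integrable_process X : Prop :=
  (ereal_sup [set 'E_P[fun w => `|X t w|%R] | t in [set: Delta]] < +oo)%E.

Definition positive_process X : Prop :=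
  forall t, {ae P, forall w, 0 <= X t w}.

(* [zip d (behead d)] lists the pairs of consecutive elements of d. *)
Definition d_variation d X (w : T) : R :=
  \sum_(p <- zip d (behead d)) `|X p.1 w - condexp P (F p.1) (X p.2) w|.

(* Strictly sorted sequences represent the finite subsets of Delta. *)
Definition qnorm X : \bar R :=
  ereal_sup [set ('E_P[d_variation d X])%E | d in [set d | sorted <%O d]].

(* Membership of each X t in L^1 is what makes P(X t | F s) meaningful; it is
   weaker than [integrable_process], which is a uniform bound. *)
Definition quasi_martingale X : Prop :=
  [/\ adapted X, forall t, in_L1 P (X t) & (qnorm X < +oo)%E].

Definition quasi_potential X : Prop :=
  quasi_martingale X /\
  exists u : nat -> Delta, forall v : nat -> Delta,
    (forall n, (u n <= v n)%O) ->
    ('E_P[fun w => `|X (v n) w|%R] @[n --> \oo] --> (0 : \bar R))%E.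

Definition supermartingale X : Prop :=
  [/\ adapted X, forall t, in_L1 P (X t) &
      forall s t, (s <= t)%O ->
        {ae P, forall w, condexp P (F s) (X t) w <= X s w}].

Definition potential X : Prop :=
  [/\ quasi_potential X, supermartingale X & positive_process X].

Definition integrable_quasi_martingale X : Prop :=
  quasi_martingale X /\ integrable_process X.

Definition positive_integrable_supermartingale X : Prop :=
  [/\ supermartingale X, positive_process X & integrable_process X].

Definition decomposition (C : (Delta -> T -> R) -> Prop) X X' X'' : Prop :=
  [/\ C X', C X'' & same_process X (diff_process X' X'')].

Definition additive_decomposition (C : (Delta -> T -> R) -> Prop) X X' X'' :
    Prop :=
  decomposition C X X' X'' /\ qnorm X = (qnorm X' + qnorm X'')%E.

Definition minimal_among_decompositions (C : (Delta -> T -> R) -> Prop)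
    X X' X'' : Prop :=
  forall Y' Y'', decomposition C X Y' Y'' ->
    C (diff_process Y' X') /\ C (diff_process Y'' X'').

End processes.

(* Main.v *)
Require Import Defs.
From HB Require Import structures.
From mathcomp Require Import all_boot all_order all_algebra.
From mathcomp Require Import all_classical all_reals all_analysis.
From mathcomp Require Import measurable_realfun lra.
Import Order.TTheory GRing.Theory Num.Theory.
Import numFieldNormedType.Exports.

Set Implicit Arguments.
Unset Strict Implicit.
Unset Printing Implicit Defensive.

Local Open Scope classical_set_scope.
Local Open Scope ring_scope.

(** For a finite increasing sequence of times s = t_0 < ... < t_n, consider

      U_s(d) = sum_(i < n) (X_(t_i) - P(X_(t_(i+1)) | F_(t_i)))^+ + (X_(t_n))^+

    where d = (t_1, ..., t_n). For A in F_s the number P(U_s(d); A), the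
    integral of U_s(d) over A, can only grow when d is refined or prolonged.
    Hence its supremum over d is a measure of A on F_s, finite as soon as X is
    an integrable quasi-martingale and absolutely continuous with respect to P.
    Let X'_s be its Radon-Nikodym density on F_s, and let X''_s be the density
    obtained in the same way from -X.

    - X' is a positive supermartingale: a sequence that starts at t prolongs to
      one that starts at s <= t.
    - X = X' - X'': by telescoping, the two sums built from X and -X along the
      same d differ, after integration over A in F_s, by P(X_s; A).
    - X' is minimal. If X = Y' - Y'' with positive supermartingales, then
      X_s - P(X_t | F_s) <= Y'_s - P(Y'_t | F_s) and the right-hand side is
      positive, so the positive part of the left-hand side is also below it. A
      sum U_s(d) is thus dominated term by term by a sum that telescopes to
      Y'_s, and splitting d at a time t shows that even the drop of X' between
      s and t is dominated by that of Y'.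
    - The norms add up: the norm of a positive supermartingale Z is the
      supremum over s <= t of P(Z_s) - P(Z_t), and for X' this difference is the
      supremum of the expectations of the positive parts in the d-variation of X
      between s and t; for X'' it is that of the negative parts.

    A quasi-potential X is an integrable quasi-martingale, and P(|X_t|) tends to
    0; then so do P(X'_t) and P(X''_t), which makes X' and X'' potentials.
    Finally, when (Y', Y'') is any additive decomposition into potentials,
    Z = Y' - X' = Y'' - X'' is a potential by minimality, and comparing norms
    gives 2 P(Z_s) <= 0 for every s. So Y' = X' and Y'' = X'', and (Y', Y'')
    inherits the minimality of (X', X'').

    Almost sure inequalities between F_s-measurable functions are handled
    throughout as inequalities between their integrals over all A in F_s; this
    is how conditional expectations enter ([Rintegral_condexp]), and no limit of
    random variables is ever taken. The construction is [upper_envelope_exists],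
    based on [directed_sup_density]; minimality is [upper_envelope_minimal],
    additivity is [upper_envelope_qnorm], and uniqueness is
    [additive_decomposition_upper_envelopes]. *)

(** * Densities on a sub-sigma-algebra *)

Section sub_sigma_algebra.
Context {dT : measure_display} {T : measurableType dT} {R : realType}.
Context (P : probability T R).
Variable G : set (set T).
Hypothesis sG : sigma_algebra setT G.
Hypothesis GM : G `<=` measurable.

Local Notation TG := (g_sigma_algebraType G).

Lemma measurable_sub_sigmaE (A : set TG) : measurable A = G A.
Proof. by rewrite measurable_g_measurableTypeE. Qed.

Lemma measurable_fun_sub_sigma_id : measurable_fun setT (id : T -> TG).
Proof.
move=> _ A mA; rewrite setTI preimage_id; apply: GM.
by rewrite -measurable_sub_sigmaE.
Qed.

Lemma measurable_wrt_measurable (f : T -> R) :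
  measurable_wrt G f -> measurable_fun setT f.
Proof. move=> mf; exact: (measurableT_comp mf measurable_fun_sub_sigma_id). Qed.

(** P on the sigma-algebra G; Radon-Nikodym over this measurable space yields
    G-measurable densities. *)
Definition trace_measure (A : set TG) : \bar R := P A.

Let trace0 : trace_measure set0 = 0%E. Proof. exact: measure0. Qed.

Let trace_ge0 A : (0 <= trace_measure A)%E. Proof. exact: measure_ge0. Qed.

Let trace_sigma_additive : semi_sigma_additive trace_measure.
Proof.
by move=> A mA tA mUA; apply: measure_semi_sigma_additive => // [i|]; apply: GM;
  rewrite -measurable_sub_sigmaE.
Qed.

HB.instance Definition _ := isMeasure.Build _ _ _ trace_measure
  trace0 trace_ge0 trace_sigma_additive.

Let trace_fin : fin_num_fun trace_measure.
Proof.
move=> A mA; apply: fin_num_measure; apply: GM.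
by rewrite -measurable_sub_sigmaE.
Qed.

HB.instance Definition _ := Measure_isFinite.Build _ _ _ trace_measure
  trace_fin.

Section directed.
Context {I : Type} (i0 : I) (h : I -> T -> R) (C : R).
Hypothesis h_ge0 : forall i w, 0 <= h i w.
Hypothesis h_L1 : forall i, in_L1 P (h i).
Hypothesis h_directed : forall i j, exists k, forall A, G A ->
  \int[P]_(w in A) h i w <= \int[P]_(w in A) h k w /\
  \int[P]_(w in A) h j w <= \int[P]_(w in A) h k w.
Hypothesis h_bounded : forall i, \int[P]_w h i w <= C.

Local Open Scope ereal_scope.

Let m (A : set TG) : \bar R :=
  ereal_sup [set \int[P]_(w in A) (h i w)%:E | i in [set: I]].

Let intE i (A : set T) : G A ->
  \int[P]_(w in A) (h i w)%:E = (\int[P]_(w in A) h i w)%:E.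
Proof.
move=> GA; rewrite fineK//; apply: integrable_fin_num; first exact: GM.
by apply: integrableS (h_L1 i) => //; exact: GM.
Qed.

Let m_ub i A : \int[P]_(w in A) (h i w)%:E <= m A.
Proof. by apply: ereal_sup_ubound; exists i. Qed.

Let m_ge0 A : 0 <= m A.
Proof.
apply: le_trans (m_ub i0 A); apply: integral_ge0 => w _.
by rewrite lee_fin.
Qed.

Let m0 : m set0 = 0.
Proof.
apply/eqP; rewrite eq_le m_ge0 andbT; apply: ge_ereal_sup => _ [i _ <-].
by rewrite integral_set0.
Qed.

Let m_fin A : G A -> m A \is a fin_num.
Proof.
move=> GA; rewrite ge0_fin_numE//; apply: (@le_lt_trans _ _ C%:E); last first.
  exact: ltry.
apply: ge_ereal_sup => _ [i _ <-].
apply: (@le_trans _ _ (\int[P]_w (h i w)%:E)).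
  apply: ge0_subset_integral => //; first exact: GM.
    by have /integrableP[] := h_L1 i.
  by move=> w _; rewrite lee_fin.
rewrite intE ?lee_fin//; case: sG => G0 GC _.
by rewrite -(setD0 setT); exact: GC.
Qed.

(** The family is directed: indices that are nearly optimal on A and on B have a
    common majorant, which is nearly optimal on the union. *)
Let m_superadditive A B : G A -> G B -> G (A `|` B) -> A `&` B = set0 ->
  m A + m B <= m (A `|` B).
Proof.
move=> GA GB GAB AB0.
have mfA := m_fin GA; have mfB := m_fin GB.
rewrite -leeBrDr//; apply: ge_ereal_sup => _ [i _ <-].
rewrite leeBrDr// intE// -leeBrDl//; apply: ge_ereal_sup => _ [j _ <-].
rewrite leeBrDl// intE//.
have [k hk] := h_directed i j.
apply: (le_trans _ (m_ub k _)).
rewrite ge0_integral_setU//; [|exact: GM|exact: GM| | |]; last first.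
- by apply/disj_setPS; rewrite AB0.
- by move=> w _; rewrite lee_fin.
- have /integrableP[mh _] := h_L1 k.
  exact: (measurable_funS measurableT _ mh).
rewrite !intE// -!EFinD lee_fin lerD//.
  by have [] := hk _ GA.
by have [] := hk _ GB.
Qed.

Let m_sigma_additive : semi_sigma_additive m.
Proof.
move=> A mA tA mUA.
have GA i : G (A i) by rewrite -measurable_sub_sigmaE.
have GUA : G (\bigcup_i A i) by rewrite -measurable_sub_sigmaE.
have GU n : G (\big[setU/set0]_(0 <= i < n) A i).
  rewrite -(@measurable_sub_sigmaE (\big[setU/set0]_(0 <= i < n) A i)).
  by rewrite big_mkord; exact: bigsetU_measurable.
have hsum n : \sum_(0 <= i < n) m (A i) <= m (\big[setU/set0]_(0 <= i < n) A i).
  elim: n => [|n IH]; first by rewrite !big_geq.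
  rewrite !big_nat_recr//=; apply: le_trans (leeD2r _ IH) _.
  apply: m_superadditive => //.
    by have := GU n.+1; rewrite big_nat_recr.
  rewrite big_mkord; apply/seteqP; split => // w [].
  rewrite -bigcup_mkord => -[k /= kn Akw] Anw.
  have kn' : k = n by apply: tA => //; exists w.
  by rewrite kn' ltnn in kn.
have m_mono B B' : G B -> G B' -> B `<=` B' -> m B <= m B'.
  move=> GB GB' BB'; apply: ge_ereal_sup => _ [i _ <-].
  apply: (le_trans _ (m_ub i _)).
  apply: ge0_subset_integral => //; [exact: GM|exact: GM| |].
    have /integrableP[mh _] := h_L1 i.
    exact: (measurable_funS measurableT _ mh).
  by move=> w _; rewrite lee_fin.
suff -> : m (\bigcup_n A n) = \sum_(0 <= i <oo) m (A i).
  by apply: is_cvg_nneseries => ? _ _; exact: m_ge0.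
apply/eqP; rewrite eq_le; apply/andP; split.
  apply: ge_ereal_sup => _ [i _ <-].
  rewrite ge0_integral_bigcup//; last 3 first.
  - by move=> k; exact: GM.
  - have /integrableP[mh _] := h_L1 i.
    exact: (measurable_funS measurableT _ mh).
  - by move=> w _; rewrite lee_fin.
  apply: lee_nneseries => [k _ _|k _]; last exact: m_ub.
  by apply: integral_ge0 => w _; rewrite lee_fin.
apply: lime_le; first by apply: is_cvg_nneseries => ? _ _; exact: m_ge0.
apply: nearW => n; apply: le_trans (hsum n) _; apply: m_mono => //.
rewrite big_mkord -bigcup_mkord; by move=> w [k _ Akw]; exists k.
Qed.

HB.instance Definition _ := isMeasure.Build _ _ _ m m0 m_ge0 m_sigma_additive.

Let m_fin_num_fun : fin_num_fun m.
Proof. by move=> A mA; apply: m_fin; rewrite -measurable_sub_sigmaE. Qed.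

HB.instance Definition _ := Measure_isFinite.Build _ _ _ m m_fin_num_fun.

Let m_dominated : m `<< trace_measure.
Proof.
apply/null_content_dominatesP => A mA PA0.
have GA : G A by rewrite -measurable_sub_sigmaE.
apply/eqP; rewrite eq_le m_ge0 andbT; apply: ge_ereal_sup => _ [i _ <-].
rewrite null_set_integral//; first exact: GM.
have /integrableP[mh _] := h_L1 i.
exact: (measurable_funS measurableT _ mh).
Qed.

Let trace_integral (A : set T) (f : T -> \bar R) : G A ->
  measurable_fun [set: TG] (f : TG -> \bar R) -> (forall w, 0 <= f w) ->
  integral trace_measure (A : set TG) (f : TG -> \bar R) = \int[P]_(w in A) f w.
Proof.
move=> GA mf f0; have mid := measurable_fun_sub_sigma_id.
transitivity (integral (pushforward P (id : T -> TG)) (A : set TG)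
  (f : TG -> \bar R)); first exact: eq_measure_integral.
rewrite ge0_integral_pushforward//; first by rewrite measurable_sub_sigmaE.
exact: measurable_funTS.
Qed.

(** The supremum of an upward directed family of measures is again a measure.
    For a constant family this is the existence of conditional expectations; for
    the sums along finite sets of times it gives the decomposition. *)
Lemma directed_sup_density : exists g : T -> R,
  [/\ measurable_wrt G g, in_L1 P g &
    forall A, G A ->
      (forall i, \int[P]_(w in A) h i w <= \int[P]_(w in A) g w)%R /\
      forall e : R, (0 < e)%R -> exists i,
        (\int[P]_(w in A) g w < \int[P]_(w in A) h i w + e)%R].
Proof.
have [f [f0 intf fE]] := radon_nikodym_finite m_dominated.
have /integrableP[mf _] := intf.
pose fT : T -> \bar R := f.
have mfT : measurable_fun [set: T] fT.
  exact: (measurableT_comp mf measurable_fun_sub_sigma_id).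
have intfT : P.-integrable setT fT.
  apply/integrableP; split => //.
  have GT : G setT by rewrite -measurable_sub_sigmaE.
  have /integrableP[_] := intf; rewrite trace_integral//.
  by apply: measurableT_comp.
(* f may be infinite on a null set; fine sends these values to 0 *)
pose g : T -> R := fine \o fT.
have fg : {ae P, forall w, setT w -> fT w = (EFin \o g) w}.
  apply: filterS (integrable_ae measurableT intfT) => w fw _.
  by rewrite /g/= fineK// fw.
have mg : measurable_wrt G g by apply: measurableT_comp.
have mgT : measurable_fun setT g := measurable_wrt_measurable mg.
have gL1 : in_L1 P g.
  apply/integrableP; split; first exact/measurable_EFinP.
  rewrite (ae_eq_integral (fun w => `|fT w|))//.
  - by have /integrableP[] := intfT.
  - by apply: measurableT_comp => //; exact/measurable_EFinP.
  - exact: measurableT_comp.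
  - by apply: filterS fg => w fgw _ /=; rewrite fgw.
exists g; split => // A GA.
have mA := GM GA.
have gE : (\int[P]_(w in A) g w)%:E = m A.
  rewrite fineK; last first.
    by apply: integrable_fin_num => //; apply: integrableS gL1.
  rewrite fE ?measurable_sub_sigmaE// trace_integral//.
  apply: ae_eq_integral => //.
  - by apply/measurable_EFinP; exact: measurable_funTS.
  - exact: measurable_funTS.
  - by apply: filterS fg => w fgw _; rewrite [RHS]fgw.
split => [i|e e0]; first by rewrite -lee_fin gE -intE.
have := @ub_ereal_sup_adherent _ _ e e0 (m_fin GA).
move=> [_ [i _ <-]]; rewrite -/(m A) -gE intE// => ge.
by exists i; rewrite -ltrBlDr -lte_fin EFinB.
Qed.

End directed.
End sub_sigma_algebra.

(** * Conditional expectation through integrals over sets *)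

Section L1.
Context {dT : measure_display} {T : measurableType dT} {R : realType}.
Context (P : probability T R).
Implicit Types (f g k : T -> R) (A B : set T).

Lemma in_L1_integrable f A :
  measurable A -> in_L1 P f -> P.-integrable A (EFin \o f).
Proof. by move=> mA; apply: integrableS. Qed.

Lemma in_L1_measurable f : in_L1 P f -> measurable_fun setT f.
Proof. by move=> /integrableP[/measurable_EFinP]. Qed.

Lemma in_L1D f g : in_L1 P f -> in_L1 P g -> in_L1 P (f \+ g).
Proof. exact: integrableD. Qed.

Lemma in_L1B f g : in_L1 P f -> in_L1 P g -> in_L1 P (f \- g).
Proof. exact: integrableB. Qed.

Lemma in_L1N f : in_L1 P f -> in_L1 P (\- f).
Proof. exact: integrableN. Qed.

Lemma in_L1_funrpos f : in_L1 P f -> in_L1 P f^\+.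
Proof. exact: integrable_funrpos. Qed.

Lemma in_L1_norm f : in_L1 P f -> in_L1 P (fun w => `|f w|).
Proof. exact: integrable_norm. Qed.

Lemma in_L1_cst0 : in_L1 P (cst 0).
Proof. exact: integrable0. Qed.

Lemma EFin_Rintegral f A : measurable A -> in_L1 P f ->
  (\int[P]_(w in A) f w)%:E = (\int[P]_(w in A) (f w)%:E)%E.
Proof.
move=> mA L1f; rewrite fineK//; apply: integrable_fin_num => //.
exact: in_L1_integrable.
Qed.

Lemma EFin_expectation f : in_L1 P f ->
  ('E_P[f] = (\int[P]_w f w)%:E)%E.
Proof. by move=> Lf; rewrite unlock EFin_Rintegral. Qed.

Lemma Rintegral_cst0 A : \int[P]_(w in A) (@cst T R 0) w = 0.
Proof. by rewrite /Rintegral integral0. Qed.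

Lemma in_L1_RintegralD f g A : measurable A -> in_L1 P f -> in_L1 P g ->
  \int[P]_(w in A) (f \+ g) w = \int[P]_(w in A) f w + \int[P]_(w in A) g w.
Proof.
by move=> mA Lf Lg; apply: RintegralD => //; exact: in_L1_integrable.
Qed.

Lemma in_L1_RintegralB f g A : measurable A -> in_L1 P f -> in_L1 P g ->
  \int[P]_(w in A) (f \- g) w = \int[P]_(w in A) f w - \int[P]_(w in A) g w.
Proof.
by move=> mA Lf Lg; apply: RintegralB => //; exact: in_L1_integrable.
Qed.

Lemma in_L1_RintegralN f A : measurable A -> in_L1 P f ->
  \int[P]_(w in A) (\- f) w = - \int[P]_(w in A) f w.
Proof.
move=> mA Lf; rewrite -mulN1r -RintegralZl//; last exact: in_L1_integrable.
by apply: eq_Rintegral => w _; rewrite mulN1r.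
Qed.

Lemma ae_eq_Rintegral f g A : measurable A -> measurable_fun setT f ->
  measurable_fun setT g -> {ae P, forall w, f w = g w} ->
  \int[P]_(w in A) f w = \int[P]_(w in A) g w.
Proof.
move=> mA mf mg fg; congr fine; apply: ae_eq_integral => //.
- by apply/measurable_EFinP; exact: measurable_funTS.
- by apply/measurable_EFinP; exact: measurable_funTS.
- by apply: filterS fg => w fgw _; rewrite fgw.
Qed.

Lemma ae_le_Rintegral f g A : measurable A -> in_L1 P f -> in_L1 P g ->
  {ae P, forall w, f w <= g w} ->
  \int[P]_(w in A) f w <= \int[P]_(w in A) g w.
Proof.
move=> mA Lf Lg fg.
rewrite (@ae_eq_Rintegral g (f \+ (g \- f)^\+) A) => //; last 3 first.
- exact: in_L1_measurable.
- by apply: in_L1_measurable; apply: in_L1D => //; exact/in_L1_funrpos/in_L1B.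
- apply: filterS fg => w fgw /=; rewrite /funrpos max_l ?subr_ge0//.
  by rewrite addrC subrK.
rewrite in_L1_RintegralD// ?lerDl; last exact/in_L1_funrpos/in_L1B.
by apply: Rintegral_ge0 => w _; rewrite /funrpos le_max lexx orbT.
Qed.

Lemma Rintegral_setID f A B : measurable A -> measurable B -> in_L1 P f ->
  \int[P]_(w in A) f w
    = \int[P]_(w in A `&` B) f w + \int[P]_(w in A `\` B) f w.
Proof.
move=> mA mB Lf; rewrite -Rintegral_setU ?setUIDK//.
- exact: measurableI.
- exact: measurableD.
- exact: in_L1_integrable.
- by apply/disj_setPS => w [[_ Bw] [_ /(_ Bw)]].
Qed.

Section sub_sigma_algebra.
Variable G : set (set T).
Hypothesis sG : sigma_algebra setT G.
Hypothesis GM : G `<=` measurable.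

Lemma sub_sigma_setT : G setT.
Proof. by rewrite -(measurable_sub_sigmaE sG). Qed.

Lemma sub_sigma_setI A B : G A -> G B -> G (A `&` B).
Proof. by rewrite -!(measurable_sub_sigmaE sG); exact: measurableI. Qed.

Lemma sub_sigma_setD A B : G A -> G B -> G (A `\` B).
Proof. by rewrite -!(measurable_sub_sigmaE sG); exact: measurableD. Qed.

Lemma measurable_wrtB f g : measurable_wrt G f -> measurable_wrt G g ->
  measurable_wrt G (f \- g).
Proof. exact: measurable_funB. Qed.

Lemma measurable_wrtN f : measurable_wrt G f -> measurable_wrt G (\- f).
Proof. by move=> mf; apply: (@measurableT_comp _ _ _ _ _ _ (@GRing.opp R)). Qed.

Lemma sub_sigma_gt0 f : measurable_wrt G f -> G [set w | 0 < f w].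
Proof.
move=> mf; rewrite -(measurable_sub_sigmaE sG).
have -> : [set w | 0 < f w] = setT `&` f @^-1` `]0, +oo[.
  by rewrite setTI; apply/seteqP; split=> w /=; rewrite in_itv/= andbT.
exact: mf.
Qed.

(** The set where g < f lies in G, and f - g is positive there with an integral
    that is at most 0. *)
Lemma ae_le_of_Rintegral_le f g : measurable_wrt G f -> measurable_wrt G g ->
  in_L1 P f -> in_L1 P g ->
  (forall A, G A -> \int[P]_(w in A) f w <= \int[P]_(w in A) g w) ->
  {ae P, forall w, f w <= g w}.
Proof.
move=> mf mg Lf Lg fg; pose A := [set w | 0 < (f \- g) w].
have GA : G A := sub_sigma_gt0 (measurable_wrtB mf mg).
have mA := GM GA.
have LB : in_L1 P (f \- g) by exact: in_L1B.
have : (\int[P]_(w in A) `|((f \- g)%R w)%:E| = 0)%E.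
  transitivity (\int[P]_(w in A) ((f \- g)%R w)%:E)%E.
    apply: eq_integral => w; rewrite inE => Aw.
    by rewrite gee0_abs//= lee_fin ltW.
  rewrite -EFin_Rintegral//; congr EFin.
  apply/eqP; rewrite eq_le; apply/andP; split.
    by rewrite in_L1_RintegralB// subr_le0 fg.
  by apply: Rintegral_ge0 => w /ltW.
have mB : measurable_fun A (EFin \o (f \- g)).
  by have /integrableP[] := in_L1_integrable mA LB.
move/(ae_eq_integral_abs P mA mB).
apply: filterS => w Aw; rewrite leNgt; apply/negP => gf.
have Aw0 : A w by rewrite /A /= subr_gt0.
by have [fg0] := Aw Aw0; move: Aw0; rewrite /A/= fg0 ltxx.
Qed.

Lemma ae_eq_of_Rintegral_eq f g : measurable_wrt G f -> measurable_wrt G g ->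
  in_L1 P f -> in_L1 P g ->
  (forall A, G A -> \int[P]_(w in A) f w = \int[P]_(w in A) g w) ->
  {ae P, forall w, f w = g w}.
Proof.
move=> mf mg Lf Lg fg.
have fg1 : {ae P, forall w, f w <= g w}.
  by apply: ae_le_of_Rintegral_le => // A GA; rewrite fg.
have fg2 : {ae P, forall w, g w <= f w}.
  by apply: ae_le_of_Rintegral_le => // A GA; rewrite fg.
by apply: filterS2 fg1 fg2 => w h1 h2; apply/eqP; rewrite eq_le h1.
Qed.

(** The integral of f^+ over A is that of f over the part B of A where f > 0,
    and B lies in G. This takes the place of Jensen's inequality for conditional
    expectations. *)
Lemma Rintegral_funrpos_le f k : measurable_wrt G f -> in_L1 P f -> in_L1 P k ->
  (forall B, G B -> 0 <= \int[P]_(w in B) k w) ->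
  (forall B, G B -> \int[P]_(w in B) f w <= \int[P]_(w in B) k w) ->
  forall A, G A -> \int[P]_(w in A) f^\+ w <= \int[P]_(w in A) k w.
Proof.
move=> mf Lf Lk k0 fk A GA; pose B := [set w | 0 < f w].
have GB : G B := sub_sigma_gt0 mf.
have -> : \int[P]_(w in A) f^\+ w = \int[P]_(w in A `&` B) f w.
  rewrite Rintegral_mkcondr; apply: eq_Rintegral => w _.
  rewrite patchE/= /funrpos; case: ifPn => [|/negP]; rewrite in_setE /B/=.
    by move=> /ltW /max_idPl.
  by move=> /negP; rewrite -leNgt => /max_idPr.
rewrite (@Rintegral_setID k A B)//; [|exact: GM|exact: GM].
apply: (le_trans (fk _ (sub_sigma_setI GA GB))).
by rewrite lerDl k0//; exact: sub_sigma_setD.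
Qed.

(** The positive and negative parts of f have densities on G. *)
Lemma condexpP f : in_L1 P f -> is_condexp P G f (condexp P G f).
Proof.
move=> Lf; suff [g gP] : exists g, is_condexp P G f g.
  exact: (@xgetPex _ (cst 0) [set g | is_condexp P G f g] (ex_intro _ g gP)).
have dens k : in_L1 P k -> (forall w, 0 <= k w) -> exists g : T -> R,
  [/\ measurable_wrt G g, in_L1 P g & forall A, G A ->
    \int[P]_(w in A) g w = \int[P]_(w in A) k w].
  move=> Lk k0.
  have [|//|g [mg Lg gk]] := @directed_sup_density _ _ _ P _ sG GM unit tt
      (fun=> k) (\int[P]_w k w) (fun=> k0) (fun=> Lk).
  - by move=> _ _; exists tt.
  - exists g; split => // A GA; have [gk1 gk2] := gk _ GA.
    apply/eqP; rewrite eq_le (gk1 tt) andbT.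
    by apply/ler_addgt0Pr => e e0; have [_ /ltW] := gk2 _ e0.
have [g1 [mg1 Lg1 g1E]] := dens _ (in_L1_funrpos Lf) (funrpos_ge0 f).
have Lfn : in_L1 P f^\- by exact: integrable_funrneg.
have [g2 [mg2 Lg2 g2E]] := dens _ Lfn (funrneg_ge0 f).
exists (g1 \- g2); split; [exact: measurable_wrtB|exact: in_L1B|].
move=> A GA; have mA := GM GA.
rewrite -!EFin_Rintegral//; last exact: in_L1B.
congr EFin; rewrite in_L1_RintegralB// g1E// g2E// -in_L1_RintegralB//.
  by apply: eq_Rintegral => w _; exact: (congr1 (fun k => k w) (funrposBneg f)).
exact: in_L1_funrpos.
Qed.

Lemma condexp_measurable_wrt f : in_L1 P f -> measurable_wrt G (condexp P G f).
Proof. by case/condexpP. Qed.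

Lemma condexp_in_L1 f : in_L1 P f -> in_L1 P (condexp P G f).
Proof. by case/condexpP. Qed.

Lemma Rintegral_condexp f A : in_L1 P f -> G A ->
  \int[P]_(w in A) condexp P G f w = \int[P]_(w in A) f w.
Proof. by case/condexpP => _ _ h GA; congr fine; exact: h. Qed.

End sub_sigma_algebra.
End L1.

(** * Conditional drops and their sums along finite sets of times *)

Section quasi_martingales.
Context {dT : measure_display} {T : measurableType dT} {R : realType}.
Context (P : probability T R).
Context {dD : Order.disp_t} {Delta : orderType dD} (F : Delta -> set (set T)).
Hypothesis F_filtration : filtration P F.
Implicit Types (X Y : Delta -> T -> R) (s t : Delta) (d : seq Delta).

Let sF t : sigma_algebra setT (F t). Proof. by case: F_filtration. Qed.

Let FM t : F t `<=` measurable.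
Proof. by case: F_filtration => _ FM _ _; exact: FM. Qed.

Let Fle s t : (s <= t)%O -> F s `<=` F t.
Proof. by case: F_filtration => _ _ Fle _; exact: Fle. Qed.

Definition adapted_L1 X : Prop := adapted F X /\ forall t, in_L1 P (X t).

Definition opp_process X : Delta -> T -> R := fun t => \- X t.

Definition mean_drop X s t : T -> R := X s \- condexp P (F s) (X t).

Fixpoint drop_sum X s d : T -> R :=
  if d is t :: d' then (mean_drop X s t)^\+ \+ drop_sum X t d' else cst 0.

(** The final positive part treats X as if it vanished after the last time of d;
    it makes the supremum over d bound X itself. *)
Definition upper_sum X s d : T -> R := drop_sum X s d \+ (X (last s d))^\+.

Lemma adapted_L1N X : adapted_L1 X -> adapted_L1 (opp_process X).
Proof.
move=> [aX LX]; split=> t; last exact: (in_L1N (LX t)).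
exact: (measurable_wrtN (aX t)).
Qed.

Lemma drop_sum_cat X s d1 d2 :
  drop_sum X s (d1 ++ d2) = drop_sum X s d1 \+ drop_sum X (last s d1) d2.
Proof.
elim: d1 s => [|t d1 IH] s /=; apply/funext => w /=; first by rewrite add0r.
by rewrite IH/= addrA.
Qed.

Lemma upper_sum_cat X s d1 d2 :
  upper_sum X s (d1 ++ d2) = drop_sum X s d1 \+ upper_sum X (last s d1) d2.
Proof.
by apply/funext => w; rewrite /upper_sum drop_sum_cat last_cat/= addrA.
Qed.

Lemma upper_sum_nil X s : upper_sum X s [::] = (X s)^\+.
Proof. by apply/funext => w; rewrite /upper_sum/= add0r. Qed.

Lemma upper_sum_cons X s t d :
  upper_sum X s (t :: d) = (mean_drop X s t)^\+ \+ upper_sum X t d.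
Proof. by apply/funext => w; rewrite /upper_sum/= addrA. Qed.

Lemma drop_sum_ge0 X s d w : 0 <= drop_sum X s d w.
Proof. by elim: d s => [|t d IH] s //=; rewrite addr_ge0// funrpos_ge0. Qed.

Lemma upper_sum_ge0 X s d w : 0 <= upper_sum X s d w.
Proof. by rewrite addr_ge0 ?drop_sum_ge0 ?funrpos_ge0. Qed.

Section adapted_process.
Variable X : Delta -> T -> R.
Hypothesis aX : adapted_L1 X.

Let LX t : in_L1 P (X t). Proof. by case: aX. Qed.

Lemma mean_drop_in_L1 s t : in_L1 P (mean_drop X s t).
Proof. by apply: in_L1B => //; apply: condexp_in_L1. Qed.

Lemma mean_drop_measurable_wrt s t : measurable_wrt (F s) (mean_drop X s t).
Proof.
by apply: measurable_wrtB; [case: aX|exact: condexp_measurable_wrt].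
Qed.

Lemma Rintegral_mean_drop s t A : F s A ->
  \int[P]_(w in A) mean_drop X s t w
    = \int[P]_(w in A) X s w - \int[P]_(w in A) X t w.
Proof.
move=> FA; rewrite in_L1_RintegralB//; [|exact: FM FA|exact: condexp_in_L1].
by rewrite Rintegral_condexp.
Qed.

Lemma drop_sum_in_L1 s d : in_L1 P (drop_sum X s d).
Proof.
elim: d s => [|t d IH] s /=; first exact: in_L1_cst0.
by apply: in_L1D => //; apply: in_L1_funrpos; exact: mean_drop_in_L1.
Qed.

Lemma upper_sum_in_L1 s d : in_L1 P (upper_sum X s d).
Proof. by apply: in_L1D; [exact: drop_sum_in_L1|exact: in_L1_funrpos]. Qed.

Lemma Rintegral_upper_sum_cons s t d A : measurable A ->
  \int[P]_(w in A) upper_sum X s (t :: d) w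
    = \int[P]_(w in A) (mean_drop X s t)^\+ w
      + \int[P]_(w in A) upper_sum X t d w.
Proof.
move=> mA; rewrite upper_sum_cons in_L1_RintegralD//.
  by apply: in_L1_funrpos; exact: mean_drop_in_L1.
exact: upper_sum_in_L1.
Qed.

Lemma Rintegral_upper_sum_cat s d1 d2 A : measurable A ->
  \int[P]_(w in A) upper_sum X s (d1 ++ d2) w
    = \int[P]_(w in A) drop_sum X s d1 w
      + \int[P]_(w in A) upper_sum X (last s d1) d2 w.
Proof.
move=> mA; rewrite upper_sum_cat in_L1_RintegralD//.
  exact: drop_sum_in_L1.
exact: upper_sum_in_L1.
Qed.

End adapted_process.

Lemma mean_dropN X s t : adapted_L1 X ->
  {ae P, forall w, mean_drop (opp_process X) s t w = - mean_drop X s t w}.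
Proof.
move=> aX; have aN := adapted_L1N aX.
apply: (ae_eq_of_Rintegral_eq (sF s) (@FM s) (P := P)
  (f := mean_drop (opp_process X) s t) (g := \- mean_drop X s t)).
- exact: mean_drop_measurable_wrt.
- by apply: measurable_wrtN; exact: mean_drop_measurable_wrt.
- exact: mean_drop_in_L1.
- by apply: in_L1N; exact: mean_drop_in_L1.
- move=> A FA; have mA := FM FA.
  rewrite in_L1_RintegralN//; last exact: mean_drop_in_L1.
  rewrite !Rintegral_mean_drop// !in_L1_RintegralN//; try by case: aX.
  by rewrite opprB opprK addrC.
Qed.

Lemma Rintegral_funrposB X s t A : adapted_L1 X -> F s A ->
  \int[P]_(w in A) (mean_drop X s t)^\+ w
    - \int[P]_(w in A) (mean_drop (opp_process X) s t)^\+ w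
  = \int[P]_(w in A) X s w - \int[P]_(w in A) X t w.
Proof.
move=> aX FA; have mA := FM FA; have aN := adapted_L1N aX.
have Lp := in_L1_funrpos (mean_drop_in_L1 aX s t).
have Ln := in_L1_funrpos (mean_drop_in_L1 aN s t).
rewrite -in_L1_RintegralB// -Rintegral_mean_drop//.
apply: ae_eq_Rintegral => //.
- exact: (in_L1_measurable (in_L1B Lp Ln)).
- by apply: in_L1_measurable; exact: mean_drop_in_L1.
- apply: filterS (mean_dropN s t aX) => w /= e.
  rewrite /funrpos e.
  exact: (congr1 (fun k => k w) (funrposBneg (mean_drop X s t))).
Qed.

(** Telescoping: positive minus negative parts leave the successive drops, and A
    belongs to the sigma-algebras of all later times. *)
Lemma Rintegral_upper_sumB X s d A : adapted_L1 X -> path <%O s d -> F s A ->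
  \int[P]_(w in A) upper_sum X s d w
    - \int[P]_(w in A) upper_sum (opp_process X) s d w
  = \int[P]_(w in A) X s w.
Proof.
move=> aX; have aN := adapted_L1N aX.
elim: d s => [|t d IH] s /= => [_|/andP[st td]] FA; have mA := FM FA.
  rewrite -in_L1_RintegralB//; try exact: upper_sum_in_L1.
  apply: eq_Rintegral => w _; rewrite /upper_sum/= !add0r.
  exact: (congr1 (fun k => k w) (funrposBneg (X s))).
rewrite !Rintegral_upper_sum_cons// opprD addrACA Rintegral_funrposB//.
by rewrite IH//; [rewrite subrK|exact: (Fle (ltW st))].
Qed.

Lemma Rintegral_upper_sum_ge X s d B : adapted_L1 X -> path <%O s d -> F s B ->
  \int[P]_(w in B) X s w <= \int[P]_(w in B) upper_sum X s d w.
Proof.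
move=> aX sd FB; rewrite -(Rintegral_upper_sumB aX sd FB) gerBl.
by apply: Rintegral_ge0 => w _; exact: upper_sum_ge0.
Qed.

(** The drop of X from s to t is in the mean, on each set of F_s, the sum of its
    drops from s to u and from u to t; each of these is at most its positive
    part. *)
Lemma mean_drop_subadditive X s u t A : adapted_L1 X -> (s <= u)%O -> F s A ->
  \int[P]_(w in A) (mean_drop X s t)^\+ w
    <= \int[P]_(w in A) (mean_drop X s u)^\+ w
       + \int[P]_(w in A) (mean_drop X u t)^\+ w.
Proof.
move=> aX su FA; have LD r r' := mean_drop_in_L1 aX r r'.
have LDp r r' := in_L1_funrpos (LD r r').
have mA := FM FA.
rewrite -in_L1_RintegralD//.
apply: (Rintegral_funrpos_le (sF s) (@FM s)) FA => //.
- exact: mean_drop_measurable_wrt.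
- exact: in_L1D.
- by move=> B _; apply: Rintegral_ge0 => w _; rewrite addr_ge0 ?funrpos_ge0.
- move=> B FB; have mB := FM FB.
  rewrite in_L1_RintegralD// Rintegral_mean_drop//.
  rewrite -(subrKA (\int[P]_(w in B) X u w)).
  rewrite -!Rintegral_mean_drop//; last exact: Fle FB.
  by apply: lerD; apply: le_Rintegral => //; do ?exact: in_L1_integrable;
    move=> w _; rewrite /funrpos le_max lexx.
Qed.

(** Refining d splits drops ([mean_drop_subadditive]); prolonging it replaces
    the final positive part by a sum that dominates it
    ([Rintegral_upper_sum_ge]). *)
Lemma Rintegral_upper_sum_subseq X s d1 d2 A : adapted_L1 X ->
  path <%O s d2 -> subseq d1 d2 -> F s A ->
  \int[P]_(w in A) upper_sum X s d1 w <= \int[P]_(w in A) upper_sum X s d2 w.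
Proof.
move=> aX; elim: d2 s d1 => [|u d2 IH] s d1 /= => [_|/andP[su ud2]].
  by move/eqP ->.
move=> d12 FA; have mA := FM FA; have FuA := Fle (ltW su) FA.
case: d1 d12 => [_|t d1].
  rewrite upper_sum_nil.
  apply: (Rintegral_funrpos_le (sF s) (@FM s)) FA.
  - by case: aX.
  - by case: aX.
  - exact: upper_sum_in_L1.
  - by move=> B _; apply: Rintegral_ge0 => w _; exact: upper_sum_ge0.
  - by move=> B FB; apply: Rintegral_upper_sum_ge => //=; rewrite su.
have [-> d12|tu d12] := eqVneq t u.
  rewrite [leLHS](Rintegral_upper_sum_cons aX s u d1 mA).
  by rewrite [leRHS](Rintegral_upper_sum_cons aX s u d2 mA) lerD2l IH.
(* u is a new time between s and t *)
apply: (@le_trans _ _ (\int[P]_(w in A) upper_sum X s (u :: t :: d1) w)).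
  rewrite [leLHS](Rintegral_upper_sum_cons aX s t d1 mA).
  rewrite [leRHS](Rintegral_upper_sum_cons aX s u (t :: d1) mA).
  rewrite [X in _ <= _ + X](Rintegral_upper_sum_cons aX u t d1 mA).
  rewrite [leRHS]addrA lerD2r.
  exact: mean_drop_subadditive (ltW su) FA.
rewrite [leLHS](Rintegral_upper_sum_cons aX s u (t :: d1) mA).
by rewrite [leRHS](Rintegral_upper_sum_cons aX s u d2 mA) lerD2l IH.
Qed.

Lemma path_lt_last s d : path <%O s d -> (s <= last s d)%O.
Proof.
rewrite lt_path_sortedE => /andP[/allP sd _].
by have := mem_last s d; rewrite inE => /predU1P[->//|/sd]; exact: ltW.
Qed.

Lemma path_lt_merge s d1 d2 : path <%O s d1 -> path <%O s d2 ->
  exists d, [/\ path <%O s d, subseq d1 d & subseq d2 d].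
Proof.
rewrite !lt_path_sortedE => /andP[s1 p1] /andP[s2 p2].
pose d := sort <=%O (undup (d1 ++ d2)).
have memd x : (x \in d) = (x \in d1) || (x \in d2).
  by rewrite mem_sort mem_undup mem_cat.
have pd : sorted <%O d by rewrite sort_lt_sorted undup_uniq.
have sub d' : sorted <%O d' -> {subset d' <= d} -> subseq d' d.
  move=> p' d'd; suff -> : d' = [seq x <- d | x \in d'] by exact: filter_subseq.
  apply: lt_sorted_eq => //; first exact: lt_sorted_filter.
  move=> x; rewrite mem_filter; case: (boolP (x \in d')) => //= xd'.
  by rewrite d'd.
exists d; split.
- rewrite lt_path_sortedE pd andbT; apply/allP => x; rewrite memd.
  by move=> /orP[]; [exact: (allP s1)|exact: (allP s2)].
- by apply: sub => // x xd; rewrite memd xd.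
- by apply: sub => // x xd; rewrite memd xd orbT.
Qed.

(** * The least positive supermartingale dominating a process and its drops *)

(** Positive supermartingales, described by integrals over the sets of each F s;
    the equivalence is [pos_supermartP]. *)
Definition pos_supermart X : Prop :=
  [/\ adapted_L1 X,
      forall s A, F s A -> 0 <= \int[P]_(w in A) X s w &
      forall s t A, (s <= t)%O -> F s A ->
        \int[P]_(w in A) X t w <= \int[P]_(w in A) X s w].

Lemma pos_supermart_mean_ge0 X t : pos_supermart X -> 0 <= \int[P]_w X t w.
Proof. by case=> _ + _; apply; exact: sub_sigma_setT (sF t). Qed.

Lemma pos_supermart_mean_le X s t : pos_supermart X -> (s <= t)%O ->
  \int[P]_w X t w <= \int[P]_w X s w.
Proof. by case=> _ _ + st; apply => //; exact: sub_sigma_setT (sF s). Qed.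

(** Y s is a version of the density on F s of the supremum of the measures with
    densities upper_sum X s d. *)
Definition upper_envelope X Y : Prop :=
  adapted_L1 Y /\ forall s A, F s A ->
    (forall d, path <%O s d ->
       \int[P]_(w in A) upper_sum X s d w <= \int[P]_(w in A) Y s w) /\
    (forall e : R, 0 < e -> exists2 d, path <%O s d &
       \int[P]_(w in A) Y s w < \int[P]_(w in A) upper_sum X s d w + e).

Definition upper_bounded X : Prop :=
  exists C : R, forall s d, path <%O s d -> \int[P]_w upper_sum X s d w <= C.

Lemma upper_envelope_exists X : adapted_L1 X -> upper_bounded X ->
  exists Y, upper_envelope X Y.
Proof.
move=> aX [C XC].
suff /choice[Y YP] : forall s, exists g : T -> R,
    [/\ measurable_wrt (F s) g, in_L1 P g & forall A, F s A ->
      (forall d, path <%O s d ->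
         \int[P]_(w in A) upper_sum X s d w <= \int[P]_(w in A) g w) /\
      (forall e : R, 0 < e -> exists2 d, path <%O s d &
         \int[P]_(w in A) g w < \int[P]_(w in A) upper_sum X s d w + e)].
  exists Y; split; first by split=> t; case: (YP t).
  by move=> s; case: (YP s).
move=> s; pose I := {d : seq Delta | path <%O s d}.
have [||g [mg Lg gP]] := @directed_sup_density _ _ _ P _ (sF s) (@FM s) I
    (exist _ [::] isT) (fun i => upper_sum X s (sval i)) C
    (fun i w => upper_sum_ge0 X s (sval i) w)
    (fun i => upper_sum_in_L1 aX s (sval i)).
- move=> [d1 p1] [d2 p2]; have [d [pd d1d d2d]] := path_lt_merge p1 p2.
  by exists (exist _ d pd) => A FA; split; exact: Rintegral_upper_sum_subseq.
- by case=> d pd; exact: XC.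
exists g; split => // A FA; have [g1 g2] := gP _ FA; split => [d pd|e e0].
  exact: (g1 (exist _ d pd)).
by have [[d pd] ?] := g2 _ e0; exists d.
Qed.

(** A sequence d after t prolongs to t :: d after s, at the cost of one more
    positive term. *)
Lemma upper_envelope_pos_supermart X Y : adapted_L1 X ->
  upper_envelope X Y -> pos_supermart Y.
Proof.
move=> aX [aY YP]; split => // [s A FA|s t A].
  have [/(_ [::] isT) + _] := YP s A FA; apply: le_trans.
  by apply: Rintegral_ge0 => w _; exact: upper_sum_ge0.
rewrite le_eqVlt => /predU1P[->//|st] FA.
have [_ Yt] := YP t A (Fle (ltW st) FA); have [Ys _] := YP s A FA.
apply/ler_addgt0Pr => e e0; have [d td /ltW /le_trans -> //] := Yt _ e0.
rewrite lerD2r; apply: le_trans (Ys (t :: d) _); last by rewrite /= st.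
rewrite (Rintegral_upper_sum_cons aX s t d (FM FA)) lerDr.
by apply: Rintegral_ge0 => w _; exact: funrpos_ge0.
Qed.

(** Concatenate d with a sequence that is nearly optimal after its last time. *)
Lemma upper_envelope_drop_ge X Y s d A : adapted_L1 X -> upper_envelope X Y ->
  path <%O s d -> F s A ->
  \int[P]_(w in A) drop_sum X s d w
    <= \int[P]_(w in A) Y s w - \int[P]_(w in A) Y (last s d) w.
Proof.
move=> aX [aY YP] sd FA; have sl := path_lt_last sd.
have [Ys _] := YP _ _ FA; have [_ Yl] := YP (last s d) A (Fle sl FA).
rewrite lerBrDr; apply/ler_addgt0Pr => e e0.
have [d' ld' lt] := Yl _ e0.
rewrite -lerBlDr -addrA.
have := Ys (d ++ d'); rewrite cat_path sd ld' => /(_ isT).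
rewrite Rintegral_upper_sum_cat//; last exact: FM FA.
by apply: le_trans; rewrite lerD2l lerBlDr ltW.
Qed.

(** Conversely, cutting a nearly optimal sequence at t shows that the drop of Y
    between s and t is no more than a supremum of drop sums. Two processes are
    treated together because additivity of the norm needs one sequence d that
    serves both X and -X. *)
Lemma upper_envelope_drop_lt X Y Z W s t A e :
  adapted_L1 X -> upper_envelope X Y -> adapted_L1 Z -> upper_envelope Z W ->
  (s <= t)%O -> F s A -> 0 < e -> exists d, [/\ path <%O s d, last s d = t,
    \int[P]_(w in A) Y s w - \int[P]_(w in A) Y t w
      < \int[P]_(w in A) drop_sum X s d w + e &
    \int[P]_(w in A) W s w - \int[P]_(w in A) W t w
      < \int[P]_(w in A) drop_sum Z s d w + e].
Proof.
move=> aX [aY YP] aZ [aW WP] st FA e0; have mA := FM FA.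
move: st; rewrite le_eqVlt => /predU1P[st|st].
  exists [::]; split; rewrite -?st//= subrr ?ltr_wpDl//; exact: Rintegral_ge0.
have FtA := Fle (ltW st) FA.
have [_ /(_ _ e0)[d1 p1 Yd1]] := YP _ _ FA.
have [_ /(_ _ e0)[d2 p2 Wd2]] := WP _ _ FA.
have [d12 [p12 d1d d2d]] := path_lt_merge p1 p2.
have [|d [pd d12d td]] := @path_lt_merge s d12 [:: t] p12.
  by rewrite /= st.
have [d' [d'' dE]] : exists d' d'', d = rcons d' t ++ d''.
  move: td; rewrite sub1seq => /splitPr[d' d'']; exists d', d''.
  by rewrite cat_rcons.
have sub1 : subseq d1 d := subseq_trans d1d d12d.
have sub2 : subseq d2 d := subseq_trans d2d d12d.
exists (rcons d' t).
move: pd; rewrite dE cat_path last_rcons => /andP[pd' pd''].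
have le U V d0 : adapted_L1 U -> upper_envelope U V -> subseq d0 d ->
    \int[P]_(w in A) V s w < \int[P]_(w in A) upper_sum U s d0 w + e ->
    \int[P]_(w in A) V s w - \int[P]_(w in A) V t w
      < \int[P]_(w in A) drop_sum U s (rcons d' t) w + e.
  move=> aU [aV VP] d0d Vlt; rewrite ltrBlDr; apply: (lt_le_trans Vlt).
  rewrite -addrA (addrC e) addrA lerD2r.
  have pd : path <%O s d by rewrite dE cat_path pd' last_rcons.
  apply: le_trans (Rintegral_upper_sum_subseq aU pd d0d FA) _.
  rewrite dE Rintegral_upper_sum_cat// last_rcons lerD2l.
  by have [+ _] := VP _ _ FtA; exact.
by split => //; [exact: (le X Y d1)|exact: (le Z W d2)].
Qed.

Lemma adapted_L1B X Y : adapted_L1 X -> adapted_L1 Y ->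
  adapted_L1 (diff_process X Y).
Proof.
by move=> [aX LX] [aY LY]; split=> t;
  [exact: (measurable_wrtB (aX t) (aY t))|exact: (in_L1B (LX t) (LY t))].
Qed.

(** Each positive part of a drop of X is dominated by the drop of U, since the
    drop of V is positive; summing telescopes. *)
Lemma upper_envelope_minimal X Y U V :
  adapted_L1 X -> upper_envelope X Y -> pos_supermart U -> pos_supermart V ->
  (forall s A, measurable A -> \int[P]_(w in A) X s w
     = \int[P]_(w in A) U s w - \int[P]_(w in A) V s w) ->
  pos_supermart (diff_process U Y).
Proof.
move=> aX XY [aU U0 Us] [aV V0 Vs] XUV.
have := XY => -[aY YP].
have LU s : in_L1 P (U s) by case: aU.
have LY s : in_L1 P (Y s) by case: aY.
have drop s t A : (s <= t)%O -> F s A ->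
    \int[P]_(w in A) (mean_drop X s t)^\+ w
      <= \int[P]_(w in A) U s w - \int[P]_(w in A) U t w.
  move=> st FA; have mA := FM FA; rewrite -Rintegral_mean_drop//.
  apply: (Rintegral_funrpos_le (sF s) (@FM s)) FA.
  - exact: mean_drop_measurable_wrt.
  - exact: mean_drop_in_L1.
  - exact: mean_drop_in_L1.
  - by move=> B FB; rewrite Rintegral_mean_drop// subr_ge0 Us.
  - move=> B FB; have mB := FM FB; rewrite !Rintegral_mean_drop// !XUV//.
    have := Vs s t B st FB; lra.
have drops s d A : path <%O s d -> F s A ->
    \int[P]_(w in A) drop_sum X s d w
      <= \int[P]_(w in A) U s w - \int[P]_(w in A) U (last s d) w.
  elim: d s => [|t d IH] s /= => [_ FA|/andP[st td] FA].
    by rewrite subrr Rintegral_cst0.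
  have LXp := in_L1_funrpos (mean_drop_in_L1 aX s t).
  rewrite (in_L1_RintegralD (FM FA) LXp (drop_sum_in_L1 aX t d)).
  have := IH t td (Fle (ltW st) FA).
  have := drop s t A (ltW st) FA; lra.
have YU s A : F s A -> \int[P]_(w in A) Y s w <= \int[P]_(w in A) U s w.
  move=> FA; have mA := FM FA; apply/ler_addgt0Pr => e e0.
  have [_ /(_ _ e0)[d sd /ltW /le_trans -> //]] := YP _ _ FA.
  rewrite lerD2r; have FlA := Fle (path_lt_last sd) FA.
  rewrite -[d]cats0 Rintegral_upper_sum_cat// -lerBrDr.
  apply: le_trans (drops _ _ _ sd FA) _.
  rewrite lerB//.
  rewrite upper_sum_nil.
  apply: (Rintegral_funrpos_le (sF _) (@FM _)) FlA => //.
  - by case: aX.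
  - by case: aX.
  - by move=> B FB; exact: U0.
  - move=> B FB; rewrite XUV; last exact: FM FB.
    by rewrite gerBl V0.
split; first exact: adapted_L1B.
- move=> s A FA; have mA := FM FA.
  by rewrite in_L1_RintegralB// subr_ge0 YU.
- move=> s t A st FA; have mA := FM FA.
  rewrite !in_L1_RintegralB//.
  suff : \int[P]_(w in A) Y s w - \int[P]_(w in A) Y t w
      <= \int[P]_(w in A) U s w - \int[P]_(w in A) U t w by lra.
  apply/ler_addgt0Pr => e e0.
  have [d [sd dt Yd _]] := upper_envelope_drop_lt aX XY aX XY st FA e0.
  by apply: le_trans (ltW Yd) _; rewrite lerD2r -dt drops.
Qed.

Lemma upper_envelopeB X Y Z s A : adapted_L1 X -> upper_envelope X Y ->
  upper_envelope (opp_process X) Z -> F s A ->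
  \int[P]_(w in A) X s w = \int[P]_(w in A) Y s w - \int[P]_(w in A) Z s w.
Proof.
move=> aX [aY YP] [aZ ZP] FA; have aN := adapted_L1N aX.
have [Y1 Y2] := YP _ _ FA; have [Z1 Z2] := ZP _ _ FA.
apply/eqP; rewrite eq_le; apply/andP; split; apply/ler_addgt0Pr => e e0.
- have [d sd] := Z2 _ e0; have := Y1 _ sd.
  have := Rintegral_upper_sumB aX sd FA; lra.
- have [d sd] := Y2 _ e0; have := Z1 _ sd.
  have := Rintegral_upper_sumB aX sd FA; lra.
Qed.

(** * The quasi-martingale norm *)

(** If f is the mean drop of X, that of -X is -f almost surely. *)
Lemma Rintegral_norm_mean_drop X s t : adapted_L1 X ->
  \int[P]_w `|mean_drop X s t w|
    = \int[P]_w (mean_drop X s t)^\+ w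
      + \int[P]_w (mean_drop (opp_process X) s t)^\+ w.
Proof.
move=> aX; have aN := adapted_L1N aX.
have LX := mean_drop_in_L1 aX s t; have LN := mean_drop_in_L1 aN s t.
rewrite -in_L1_RintegralD//; try exact: in_L1_funrpos.
apply: ae_eq_Rintegral => //.
- exact: (in_L1_measurable (in_L1_norm LX)).
- exact: (in_L1_measurable (in_L1D (in_L1_funrpos LX) (in_L1_funrpos LN))).
- apply: filterS (mean_dropN s t aX) => w /= e; rewrite /funrpos e.
  exact/esym/(congr1 (fun k => k w) (funrposDneg (mean_drop X s t))).
Qed.

Lemma d_variation1 X s : d_variation P F [:: s] X = cst 0.
Proof. by apply/funext => w; rewrite /d_variation/= big_nil. Qed.

Lemma d_variation_cons X s t d : d_variation P F (s :: t :: d) X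
  = (fun w => `|mean_drop X s t w|) \+ d_variation P F (t :: d) X.
Proof. by apply/funext => w; rewrite /d_variation/= big_cons. Qed.

Lemma in_L1_d_variation X s d :
  adapted_L1 X -> in_L1 P (d_variation P F (s :: d) X).
Proof.
move=> aX; elim: d s => [|t d IH] s.
  by rewrite d_variation1; exact: in_L1_cst0.
by rewrite d_variation_cons; apply: in_L1D => //; apply: in_L1_norm;
  exact: mean_drop_in_L1.
Qed.

Lemma Rintegral_d_variation X s d : adapted_L1 X ->
  \int[P]_w d_variation P F (s :: d) X w
    = \int[P]_w drop_sum X s d w + \int[P]_w drop_sum (opp_process X) s d w.
Proof.
move=> aX; have aN := adapted_L1N aX; elim: d s => [|t d IH] s.
  rewrite -in_L1_RintegralD//=; try exact: in_L1_cst0.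
  by rewrite d_variation1; apply: eq_Rintegral => w _ /=; rewrite addr0.
rewrite d_variation_cons.
have Ln := in_L1_norm (mean_drop_in_L1 aX s t).
rewrite (in_L1_RintegralD measurableT Ln (in_L1_d_variation t d aX)).
have LXp := in_L1_funrpos (mean_drop_in_L1 aX s t).
have LNp := in_L1_funrpos (mean_drop_in_L1 aN s t).
rewrite IH Rintegral_norm_mean_drop//=.
rewrite (in_L1_RintegralD measurableT LXp (drop_sum_in_L1 aX t d)).
rewrite (in_L1_RintegralD measurableT LNp (drop_sum_in_L1 aN t d)).
by rewrite [LHS]addrACA.
Qed.

Lemma qnorm_ge0 X : (0 <= qnorm P F X)%E.
Proof.
apply: ereal_sup_ubound; exists [::] => //.
by rewrite unlock /d_variation/=; under eq_integral do rewrite big_nil;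
  rewrite integral0.
Qed.

Lemma drop_sum_le_qnorm X s d : adapted_L1 X -> path <%O s d ->
  ((\int[P]_w drop_sum X s d w
    + \int[P]_w drop_sum (opp_process X) s d w)%:E <= qnorm P F X)%E.
Proof.
move=> aX sd; apply: ereal_sup_ubound; exists (s :: d) => //.
by rewrite EFin_expectation ?Rintegral_d_variation//; exact: in_L1_d_variation.
Qed.

Lemma qnorm_le X c : adapted_L1 X -> 0 <= c ->
  (forall s d, path <%O s d -> \int[P]_w drop_sum X s d w
    + \int[P]_w drop_sum (opp_process X) s d w <= c) ->
  (qnorm P F X <= c%:E)%E.
Proof.
move=> aX c0 Xc; apply: ge_ereal_sup => _ [[|s d] sd <-].
  rewrite unlock /d_variation/=; under eq_integral do rewrite big_nil.
  by rewrite integral0 lee_fin.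
rewrite EFin_expectation; last exact: in_L1_d_variation.
by rewrite Rintegral_d_variation// lee_fin Xc.
Qed.

(** The drops of a supermartingale are positive, so its variation is the sum of
    the drops, which telescopes. *)
Lemma pos_supermart_drop_sum X s d : pos_supermart X -> path <%O s d ->
  \int[P]_w drop_sum X s d w + \int[P]_w drop_sum (opp_process X) s d w
    = \int[P]_w X s w - \int[P]_w X (last s d) w.
Proof.
move=> [aX X0 Xs]; have aN := adapted_L1N aX.
have LX t : in_L1 P (X t) by case: aX.
elim: d s => [|t d IH] s /= => [_|/andP[st td]].
  by rewrite !Rintegral_cst0 addr0 subrr.
have LXp := in_L1_funrpos (mean_drop_in_L1 aX s t).
have LNp := in_L1_funrpos (mean_drop_in_L1 aN s t).
have FT : F s setT by exact: sub_sigma_setT (sF s).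
rewrite (in_L1_RintegralD measurableT LXp (drop_sum_in_L1 aX t d)).
rewrite (in_L1_RintegralD measurableT LNp (drop_sum_in_L1 aN t d)).
have n0 : \int[P]_w (mean_drop (opp_process X) s t)^\+ w = 0.
  apply/eqP; rewrite eq_le; apply/andP; split; last first.
    by apply: Rintegral_ge0 => w _; exact: funrpos_ge0.
  rewrite -(Rintegral_cst0 P setT).
  apply: (Rintegral_funrpos_le (sF s) (@FM s) _ _ _ _ _ FT).
  - exact: mean_drop_measurable_wrt.
  - exact: mean_drop_in_L1.
  - exact: in_L1_cst0.
  - by move=> B _; rewrite Rintegral_cst0.
  - move=> B FB; have mB := FM FB; rewrite Rintegral_cst0 Rintegral_mean_drop//.
    rewrite !in_L1_RintegralN//; have := Xs s t B (ltW st) FB; lra.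
have := Rintegral_funrposB t aX FT; rewrite n0 subr0 => p0.
by rewrite [LHS]addrACA (IH t td) addr0 p0 subrKA.
Qed.

Lemma pos_supermart_qnorm_ge X s t : pos_supermart X -> (s <= t)%O ->
  ((\int[P]_w X s w - \int[P]_w X t w)%:E <= qnorm P F X)%E.
Proof.
move=> pX; have [aX _ _] := pX; rewrite le_eqVlt => /predU1P[->|st].
  by rewrite subrr qnorm_ge0.
have sd : path <%O s [:: t] by rewrite /= st.
by rewrite -(pos_supermart_drop_sum pX sd) drop_sum_le_qnorm.
Qed.

Lemma pos_supermart_qnorm_le X c : pos_supermart X -> 0 <= c ->
  (forall s t, (s <= t)%O -> \int[P]_w X s w - \int[P]_w X t w <= c) ->
  (qnorm P F X <= c%:E)%E.
Proof.
move=> pX c0 Xc; have [aX _ _] := pX; apply: qnorm_le => // s d sd.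
by rewrite pos_supermart_drop_sum// Xc//; exact: path_lt_last.
Qed.

(** The mean drop of Y between s and t is the supremum of the expected drop sums
    of X, that of Z is the supremum for -X, and the expected variation of X
    along d is the sum of the two drop sums. *)
Lemma upper_envelope_qnorm X Y Z : adapted_L1 X -> (qnorm P F X < +oo)%E ->
  upper_envelope X Y -> upper_envelope (opp_process X) Z ->
  qnorm P F X = (qnorm P F Y + qnorm P F Z)%E.
Proof.
move=> aX qX XY XZ; have aN := adapted_L1N aX.
have pY := upper_envelope_pos_supermart aX XY.
have pZ := upper_envelope_pos_supermart aN XZ.
have FT s : F s setT by exact: sub_sigma_setT (sF s).
have [q qE] : exists q : R, qnorm P F X = q%:E.
  by exists (fine (qnorm P F X)); rewrite fineK// ge0_fin_numE ?qnorm_ge0.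
have q0 : 0 <= q by rewrite -lee_fin -qE qnorm_ge0.
have YZ s t : (s <= t)%O -> (\int[P]_w Y s w - \int[P]_w Y t w)
    + (\int[P]_w Z s w - \int[P]_w Z t w) <= q.
  move=> st; apply/ler_addgt0Pr => e e0.
  have e20 : 0 < e / 2 by rewrite divr_gt0.
  have [d [sd dt Yd Zd]] := upper_envelope_drop_lt aX XY aN XZ st (FT s) e20.
  have := drop_sum_le_qnorm aX sd; rewrite qE lee_fin; lra.
have [y yE] : exists2 y : R, qnorm P F Y = y%:E & 0 <= y.
  have : (qnorm P F Y <= q%:E)%E.
    apply: pos_supermart_qnorm_le => // s t st.
    have := YZ s t st; have := pos_supermart_mean_le pZ st; lra.
  move: (qnorm_ge0 Y); case: (qnorm P F Y) => [y|//|//] y0 _.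
  by exists y.
have [z zE] : exists2 z : R, qnorm P F Z = z%:E & 0 <= z.
  have : (qnorm P F Z <= q%:E)%E.
    apply: pos_supermart_qnorm_le => // s t st.
    have := YZ s t st; have := pos_supermart_mean_le pY st; lra.
  move: (qnorm_ge0 Z); case: (qnorm P F Z) => [z|//|//] z0 _.
  by exists z.
move=> z0 y0.
have Yy s t : (s <= t)%O -> \int[P]_w Y s w - \int[P]_w Y t w <= y.
  by move=> st; rewrite -lee_fin -yE pos_supermart_qnorm_ge.
have Zz s t : (s <= t)%O -> \int[P]_w Z s w - \int[P]_w Z t w <= z.
  by move=> st; rewrite -lee_fin -zE pos_supermart_qnorm_ge.
rewrite yE zE -EFinD; apply/eqP; rewrite eq_le; apply/andP; split.
  apply: qnorm_le => //; first exact: addr_ge0.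
  move=> s d sd; have sl := path_lt_last sd.
  have := upper_envelope_drop_ge aX XY sd (FT s).
  have := upper_envelope_drop_ge aN XZ sd (FT s).
  have := Yy _ _ sl; have := Zz _ _ sl; lra.
(* a common interval of time serves both suprema, since widening an interval
   only increases the mean drops *)
have wide s t s' t' : (s <= t)%O -> (s' <= t')%O ->
    (\int[P]_w Y s w - \int[P]_w Y t w)
    + (\int[P]_w Z s' w - \int[P]_w Z t' w) <= q.
  move=> st st'; pose a := Order.min s s'; pose b := Order.max t t'.
  have sa : (a <= s)%O by rewrite ge_min lexx.
  have sa' : (a <= s')%O by rewrite ge_min lexx orbT.
  have tb : (t <= b)%O by rewrite le_max lexx.
  have tb' : (t' <= b)%O by rewrite le_max lexx orbT.
  have := YZ a b (le_trans sa (le_trans st tb)).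
  have := pos_supermart_mean_le pY sa; have := pos_supermart_mean_le pY tb.
  have := pos_supermart_mean_le pZ sa'; have := pos_supermart_mean_le pZ tb'.
  lra.
have zq : z <= q.
  rewrite -lee_fin -zE; apply: pos_supermart_qnorm_le => // s t st.
  by have := wide s s s t (lexx _) st; rewrite subrr add0r.
rewrite qE lee_fin -lerBrDr -lee_fin -yE.
apply: pos_supermart_qnorm_le => // [|s t st]; first by rewrite subr_ge0.
rewrite lerBrDr addrC -lerBrDr -lee_fin -zE.
apply: pos_supermart_qnorm_le => // [|s' t' st'].
  by have := wide s t t t st (lexx _); rewrite subrr addr0 subr_ge0.
by rewrite lerBrDr addrC wide.
Qed.

(** * Potentials, quasi-potentials and integrable processes *)

Definition mean_bounded X : Prop :=
  exists C : R, forall t, \int[P]_w X t w <= C.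

Definition mean_vanishing X : Prop :=
  forall e : R, 0 < e -> exists s, forall t, (s <= t)%O -> \int[P]_w X t w < e.

Definition norm_process X : Delta -> T -> R := fun t w => `|X t w|.

Lemma norm_process_in_L1 X t : in_L1 P (X t) -> in_L1 P (norm_process X t).
Proof. exact: in_L1_norm. Qed.

Lemma pos_supermartP X :
  supermartingale P F X /\ positive_process P X <-> pos_supermart X.
Proof.
split=> [[[aX LX Xs] X0]|[[aX LX] X0 Xs]].
  split=> // [s A FA|s t A st FA]; have mA := FM FA.
    rewrite -(Rintegral_cst0 P A); apply: ae_le_Rintegral => //.
    exact: in_L1_cst0.
  rewrite -(Rintegral_condexp (sF s) (@FM s) (LX t) FA).
  apply: ae_le_Rintegral => //; [exact: condexp_in_L1|exact: Xs].
split; last first.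
  move=> s; apply: (ae_le_of_Rintegral_le (sF s) (@FM s) (f := cst 0)
    _ (aX s) (in_L1_cst0 P) (LX s)) => [|A FA]; first exact: measurable_cst.
  by rewrite Rintegral_cst0 X0.
split=> // s t st.
apply: (ae_le_of_Rintegral_le (sF s) (@FM s) _ (aX s) _ (LX s)).
- exact: condexp_measurable_wrt.
- exact: condexp_in_L1.
- by move=> A FA; rewrite (Rintegral_condexp (sF s) (@FM s)) ?Xs.
Qed.

Lemma pos_supermart_norm X t : pos_supermart X ->
  \int[P]_w norm_process X t w = \int[P]_w X t w.
Proof.
move=> /[dup] -[[aX LX] _ _] /pos_supermartP[_ X0].
apply: ae_eq_Rintegral => //.
- exact: (in_L1_measurable (in_L1_norm (LX t))).
- exact: (in_L1_measurable (LX t)).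
- by apply: filterS (X0 t) => w; exact: ger0_norm.
Qed.

Lemma integrable_processP X : (forall t, in_L1 P (X t)) ->
  integrable_process P X <-> mean_bounded (norm_process X).
Proof.
move=> LX; have EN t := EFin_expectation (norm_process_in_L1 (LX t)).
split=> [|[C XC]]; last first.
  apply: (@le_lt_trans _ _ C%:E); last exact: ltry.
  by apply: ge_ereal_sup => _ [t _ <-]; rewrite EN lee_fin.
rewrite /integrable_process; set S := ereal_sup _ => Sy.
have Sub t : ((\int[P]_w norm_process X t w)%:E <= S)%E.
  by rewrite -EN; apply: ereal_sup_ubound; exists t.
exists (fine S) => t; rewrite -lee_fin (@fineK _ S) ?Sub//.
by rewrite fin_numElt Sy (lt_le_trans (ltNyr _) (Sub t)).
Qed.

(** If the means of |X| did not converge to 0, then beyond each u n a time v n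
    with a large mean could be chosen; conversely, u n is a time after which the
    means are below 1/(n+1). *)
Lemma quasi_potentialP X : quasi_potential P F X <->
  quasi_martingale P F X /\ mean_vanishing (norm_process X).
Proof.
split=> -[qX]; split=> //; have [aX LX _] := qX.
- case: b => u uP e e0; apply: contrapT => /forallNP H.
  have /choice[v vP] : forall n, exists t,
      (u n <= t)%O /\ e <= \int[P]_w norm_process X t w.
    move=> n; have /existsNP[t /not_implyP[ut /negP]] := H (u n).
    by rewrite -leNgt => et; exists t.
  have /fine_cvgP[_] := uP v (fun n => (vP n).1).
  move=> /cvgrPdist_lt/(_ _ e0)[N _ /(_ N (leqnn _))]/=.
  rewrite (EFin_expectation (norm_process_in_L1 (LX _)))/= sub0r normrN.
  by move=> /(le_lt_trans (ler_norm _)); rewrite ltNge (vP N).2.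
- have /choice[u uP] : forall n : nat, exists s, forall t, (s <= t)%O ->
      \int[P]_w norm_process X t w < n.+1%:R^-1 by move=> n; exact: b.
  exists u => v uv.
  under eq_fun do rewrite (EFin_expectation (norm_process_in_L1 (LX _))).
  apply: cvg_EFin; first exact: nearW.
  apply/cvgrPdist_lt => e e0; near=> n; rewrite sub0r normrN ger0_norm.
    apply: lt_trans (uP n _ (uv n)) _; near: n.
    exact: near_infty_natSinv_lt (PosNum e0).
  by apply: Rintegral_ge0 => w _; exact: normr_ge0.
Unshelve. all: end_near. Qed.

Lemma mean_bounded_qnorm X : pos_supermart X -> mean_bounded X ->
  (qnorm P F X < +oo)%E.
Proof.
move=> pX [C XC]; apply: (@le_lt_trans _ _ (Num.max C 0)%:E); last exact: ltry.
apply: pos_supermart_qnorm_le => // [|s t _]; first by rewrite le_max lexx orbT.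
rewrite le_max; apply/orP; left; apply: le_trans (XC s).
by rewrite gerBl pos_supermart_mean_ge0.
Qed.

Lemma pos_int_supermartP X : positive_integrable_supermartingale P F X <->
  pos_supermart X /\ mean_bounded X.
Proof.
have boundedE : pos_supermart X -> integrable_process P X <-> mean_bounded X.
  move=> pX; have [[_ LX] _ _] := pX.
  have [h1 h2] := integrable_processP LX.
  split=> [/h1[C XC]|[C XC]]; last apply: h2;
    by exists C => t; have := XC t; rewrite pos_supermart_norm.
split=> [[sX X0 iX]|[pX bX]].
  by have pX := (pos_supermartP X).1 (conj sX X0); split=> //; exact/boundedE.
by have [sX X0] := (pos_supermartP X).2 pX; split=> //; exact/boundedE.
Qed.

Lemma potentialP X :
  potential P F X <-> [/\ pos_supermart X, mean_bounded X & mean_vanishing X].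
Proof.
split=> [[qX sX X0]|[pX bX vX]].
  have pX := (pos_supermartP X).1 (conj sX X0).
  have [[_ _ qy] nX] := (quasi_potentialP X).1 qX.
  have vX : mean_vanishing X.
    move=> e e0; have [s sX'] := nX e e0; exists s => t st.
    by rewrite -pos_supermart_norm// sX'.
  split=> //; have [s0 s0P] := vX _ ltr01.
  exists (fine (qnorm P F X) + 1) => s.
  have st : (s <= Order.max s s0)%O by rewrite le_max lexx.
  have := s0P (Order.max s s0); rewrite le_max lexx orbT => /(_ isT).
  have := pos_supermart_qnorm_ge pX st.
  have qf : qnorm P F X \is a fin_num by rewrite ge0_fin_numE// qnorm_ge0.
  rewrite -(fineK qf) lee_fin; lra.
have [[aX LX] _ _] := pX; have [sX X0] := (pos_supermartP X).2 pX.
split=> //; apply/quasi_potentialP; split.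
  by split=> //; exact: mean_bounded_qnorm.
move=> e e0; have [s sP] := vX e e0; exists s => t st.
by rewrite pos_supermart_norm// sP.
Qed.

Lemma Rintegral_upper_sumD X s d : adapted_L1 X ->
  \int[P]_w upper_sum X s d w + \int[P]_w upper_sum (opp_process X) s d w
  = \int[P]_w drop_sum X s d w + \int[P]_w drop_sum (opp_process X) s d w
    + \int[P]_w norm_process X (last s d) w.
Proof.
move=> aX; have aN := adapted_L1N aX.
have LX t : in_L1 P (X t) by case: aX.
have LN t : in_L1 P (opp_process X t) by case: aN.
have normE : \int[P]_w norm_process X (last s d) w
    = \int[P]_w (X (last s d))^\+ w
      + \int[P]_w (opp_process X (last s d))^\+ w.
  rewrite -in_L1_RintegralD//; try exact: in_L1_funrpos.
  apply: eq_Rintegral => w _.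
  exact/esym/(congr1 (fun k => k w) (funrposDneg (X (last s d)))).
rewrite normE.
rewrite (in_L1_RintegralD measurableT (drop_sum_in_L1 aX s d)
  (in_L1_funrpos (LX _))).
rewrite (in_L1_RintegralD measurableT (drop_sum_in_L1 aN s d)
  (in_L1_funrpos (LN _))).
by rewrite [LHS]addrACA.
Qed.

(** |X s| is the sum of the upper sums of X and -X along the empty sequence, and
    these only grow in the mean along a sequence from s to t. *)
Lemma norm_process_mean_le X s t q : adapted_L1 X -> (s <= t)%O ->
  qnorm P F X = q%:E ->
  \int[P]_w norm_process X s w <= q + \int[P]_w norm_process X t w.
Proof.
move=> aX st qE; have aN := adapted_L1N aX.
have [d sd <-] : exists2 d, path <%O s d & last s d = t.
  move: st; rewrite le_eqVlt => /predU1P[->|st]; first by exists [::].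
  by exists [:: t] => //=; rewrite st.
have FT : F s setT by exact: sub_sigma_setT (sF s).
have := Rintegral_upper_sum_subseq aX sd (sub0seq d) FT.
have := Rintegral_upper_sum_subseq aN sd (sub0seq d) FT.
have := Rintegral_upper_sumD s d aX; have := Rintegral_upper_sumD s [::] aX.
have := drop_sum_le_qnorm aX sd; rewrite qE lee_fin.
rewrite !Rintegral_cst0/= !add0r; lra.
Qed.

(** The means of |X| are bounded beyond some time t, hence everywhere by
    [norm_process_mean_le]. *)
Lemma quasi_potential_mean_bounded X :
  quasi_potential P F X -> mean_bounded (norm_process X).
Proof.
move=> /quasi_potentialP[[aX LX qX] /(_ _ ltr01)[s0 s0P]].
have qE : qnorm P F X = (fine (qnorm P F X))%:E.
  by rewrite fineK// ge0_fin_numE// qnorm_ge0.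
exists (fine (qnorm P F X) + 1) => s.
have st : (s <= Order.max s s0)%O by rewrite le_max lexx.
apply: le_trans (norm_process_mean_le (conj aX LX) st qE) _.
by rewrite lerD2l ltW// s0P// le_max lexx orbT.
Qed.

Lemma upper_envelopes_exist X : adapted_L1 X -> (qnorm P F X < +oo)%E ->
  mean_bounded (norm_process X) -> exists Y Z,
  [/\ upper_envelope X Y, upper_envelope (opp_process X) Z,
      mean_bounded Y & mean_bounded Z].
Proof.
move=> aX qX [C XC]; have aN := adapted_L1N aX.
have [q qE] : exists q : R, qnorm P F X = q%:E.
  by exists (fine (qnorm P F X)); rewrite fineK// ge0_fin_numE ?qnorm_ge0.
have bound s d : path <%O s d -> \int[P]_w upper_sum X s d w
    + \int[P]_w upper_sum (opp_process X) s d w <= q + C.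
  move=> sd; rewrite Rintegral_upper_sumD// lerD//.
  by rewrite -lee_fin -qE drop_sum_le_qnorm.
have u0 U s d : 0 <= \int[P]_w upper_sum U s d w.
  by apply: Rintegral_ge0 => w _; exact: upper_sum_ge0.
have mean_le U V : upper_envelope U V ->
    (forall s d, path <%O s d -> \int[P]_w upper_sum U s d w <= q + C) ->
    mean_bounded V.
  move=> [_ UV] Ub; exists (q + C + 1) => s.
  have [_ /(_ _ ltr01)[d sd /ltW/le_trans-> //]] :=
    UV s setT (sub_sigma_setT (sF s)).
  by rewrite lerD2r Ub.
have bX s d : path <%O s d -> \int[P]_w upper_sum X s d w <= q + C.
  by move=> sd; apply: le_trans (bound _ _ sd); rewrite lerDl.
have bN s d : path <%O s d ->
    \int[P]_w upper_sum (opp_process X) s d w <= q + C.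
  by move=> sd; apply: le_trans (bound _ _ sd); rewrite lerDr.
have [Y XY] : exists Y, upper_envelope X Y.
  by apply: upper_envelope_exists => //; exists (q + C).
have [Z XZ] : exists Z, upper_envelope (opp_process X) Z.
  by apply: upper_envelope_exists => //; exists (q + C).
by exists Y, Z; split => //; [exact: mean_le XY bX|exact: mean_le XZ bN].
Qed.

(** P(Y s) is nearly a drop sum up to some time t plus P((X t)^+), and the drop
    sum is at most P(Y s) - P(Y t); so P(Y t) is hardly more than P((X t)^+). *)
Lemma upper_envelope_mean_vanishing X Y : adapted_L1 X -> upper_envelope X Y ->
  mean_vanishing (norm_process X) -> mean_vanishing Y.
Proof.
move=> aX XY vX e e0; have pY := upper_envelope_pos_supermart aX XY.
have LX t : in_L1 P (X t) by case: aX.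
have e20 : 0 < e / 2 by rewrite divr_gt0.
have [s sP] := vX _ e20; have FT : F s setT by exact: sub_sigma_setT (sF s).
have [_ /(_ _ e20)[d sd Yd]] := XY.2 _ _ FT.
exists (last s d) => t /(pos_supermart_mean_le pY)/le_lt_trans; apply.
have pn : \int[P]_w (X (last s d))^\+ w
    <= \int[P]_w norm_process X (last s d) w.
  apply: le_Rintegral => //; first exact: in_L1_funrpos.
    exact: norm_process_in_L1.
  by move=> w _; rewrite /funrpos ge_max ler_norm normr_ge0.
have := upper_envelope_drop_ge aX XY sd FT.
have := sP _ (path_lt_last sd).
move: Yd; rewrite -[d in upper_sum _ _ d]cats0 Rintegral_upper_sum_cat//.
rewrite upper_sum_nil; lra.
Qed.

(** * Decompositions *)

Lemma same_process_in_L1 X Y t : adapted F X -> same_process P X Y ->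
  in_L1 P (Y t) -> in_L1 P (X t).
Proof.
move=> aX XY /[dup] LY /integrableP[mY intY].
have mX : measurable_fun setT (X t).
  exact: (measurable_wrt_measurable (sF t) (@FM t) (aX t)).
apply/integrableP; split; first exact/measurable_EFinP.
rewrite (ae_eq_integral (fun w => `|(Y t w)%:E|)%E)//.
- by apply: measurableT_comp => //; exact/measurable_EFinP.
- by apply: measurableT_comp.
- by apply: filterS (XY t) => w e _ /=; rewrite e.
Qed.

Lemma same_process_Rintegral X Y s A : adapted_L1 X -> adapted_L1 Y ->
  same_process P X Y -> measurable A ->
  \int[P]_(w in A) X s w = \int[P]_(w in A) Y s w.
Proof.
move=> [_ LX] [_ LY] XY mA; apply: ae_eq_Rintegral => //.
- exact: (in_L1_measurable (LX s)).
- exact: (in_L1_measurable (LY s)).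
Qed.

Lemma decomposition_Rintegral X Y Z s A :
  adapted_L1 X -> adapted_L1 Y -> adapted_L1 Z ->
  same_process P X (diff_process Y Z) -> measurable A ->
  \int[P]_(w in A) X s w = \int[P]_(w in A) Y s w - \int[P]_(w in A) Z s w.
Proof.
move=> aX aY aZ XYZ mA.
rewrite (same_process_Rintegral s aX (adapted_L1B aY aZ) XYZ mA).
by rewrite in_L1_RintegralB//; [case: aY|case: aZ].
Qed.

Lemma upper_envelopes_decomposition X Y Z : adapted_L1 X ->
  upper_envelope X Y -> upper_envelope (opp_process X) Z ->
  same_process P X (diff_process Y Z).
Proof.
move=> aX XY XZ s; have [aY _] := XY; have [aZ _] := XZ.
have [aYZ LYZ] := adapted_L1B aY aZ.
apply: (ae_eq_of_Rintegral_eq (sF s) (@FM s) _ _ _ (LYZ s)).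
- by case: aX.
- exact: aYZ.
- by case: aX.
- move=> A FA; rewrite (upper_envelopeB aX XY XZ FA).
  rewrite in_L1_RintegralB//; [exact: FM FA|by case: aY|by case: aZ].
Qed.

Lemma upper_envelopes_minimal X Y Z U V : adapted_L1 X ->
  upper_envelope X Y -> upper_envelope (opp_process X) Z ->
  pos_supermart U -> pos_supermart V -> same_process P X (diff_process U V) ->
  pos_supermart (diff_process U Y) /\ pos_supermart (diff_process V Z).
Proof.
move=> aX XY XZ pU pV XUV; have [aU _ _] := pU; have [aV _ _] := pV.
split.
  apply: (upper_envelope_minimal aX XY pU pV) => s A mA.
  exact: decomposition_Rintegral.
apply: (upper_envelope_minimal (adapted_L1N aX) XZ pV pU) => s A mA.
rewrite in_L1_RintegralN//; last by case: aX.
by rewrite (decomposition_Rintegral s aX aU aV XUV mA) opprB.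
Qed.

Lemma diff_process_mean_le U Y t : pos_supermart U -> pos_supermart Y ->
  \int[P]_w diff_process U Y t w <= \int[P]_w U t w.
Proof.
move=> [[_ LU] _ _] pY; have [[_ LY] _ _] := pY.
by rewrite in_L1_RintegralB// gerBl pos_supermart_mean_ge0.
Qed.

Lemma mean_bounded_diff U Y : pos_supermart U -> pos_supermart Y ->
  mean_bounded U -> mean_bounded (diff_process U Y).
Proof.
move=> pU pY [C UC]; exists C => t.
exact: le_trans (diff_process_mean_le t pU pY) (UC t).
Qed.

Lemma mean_vanishing_diff U Y : pos_supermart U -> pos_supermart Y ->
  mean_vanishing U -> mean_vanishing (diff_process U Y).
Proof.
move=> pU pY vU e e0; have [s sP] := vU e e0; exists s => t st.
exact: le_lt_trans (diff_process_mean_le t pU pY) (sP t st).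
Qed.

(** As the means of U vanish along Delta, the norm of U is the supremum of its
    means; these exceed the means of Y by those of U - Y, which decrease in
    time, so the excess at an early enough time is at least the one at s. *)
Lemma qnorm_gap U Y s : pos_supermart U -> pos_supermart Y ->
  pos_supermart (diff_process U Y) -> mean_bounded U -> mean_vanishing U ->
  (qnorm P F Y + (\int[P]_w diff_process U Y s w)%:E <= qnorm P F U)%E.
Proof.
move=> pU pY pD bU vU; have [[_ LU] _ _] := pU; have [[_ LY] _ _] := pY.
have DE t : \int[P]_w diff_process U Y t w
    = \int[P]_w U t w - \int[P]_w Y t w by rewrite in_L1_RintegralB.
have qU : qnorm P F U = (fine (qnorm P F U))%:E.
  by rewrite fineK// ge0_fin_numE ?qnorm_ge0// mean_bounded_qnorm.
set q := fine _ in qU.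
have key s' : \int[P]_w Y s' w + \int[P]_w diff_process U Y s w <= q.
  apply/ler_addgt0Pr => e e0; have [t tP] := vU e e0.
  pose a := Order.min s s'; pose b := Order.max a t.
  have as_ : (a <= s)%O by rewrite ge_min lexx.
  have as' : (a <= s')%O by rewrite ge_min lexx orbT.
  have ab : (a <= b)%O by rewrite le_max lexx.
  have := tP b; rewrite le_max lexx orbT => /(_ isT).
  have := pos_supermart_qnorm_ge pU ab; rewrite qU lee_fin.
  have := DE a; have := pos_supermart_mean_le pY as'.
  have := pos_supermart_mean_le pD as_; lra.
rewrite qU -leeBrDr// -EFinB; apply: pos_supermart_qnorm_le => // [|s' t' st'].
  rewrite subr_ge0; apply: le_trans (key s).
  by rewrite lerDr pos_supermart_mean_ge0.
have := key s'; have := pos_supermart_mean_ge0 t' pY; lra.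
Qed.

Lemma pos_supermart_mean0 X s A :
  pos_supermart X -> \int[P]_w X s w <= 0 -> F s A ->
  \int[P]_(w in A) X s w = 0.
Proof.
move=> [[_ LX] X0 _] Xs FA; have mA := FM FA.
have := Rintegral_setID measurableT mA (LX s); rewrite setTI => E.
have FD : F s (setT `\` A).
  exact: (sub_sigma_setD (sF s) (sub_sigma_setT (sF s)) FA).
by have := X0 _ _ FA; have := X0 _ _ FD; lra.
Qed.

Lemma upper_envelope_eq X Y U : upper_envelope X Y -> adapted_L1 U ->
  (forall s A, F s A -> \int[P]_(w in A) diff_process U Y s w = 0) ->
  upper_envelope X U.
Proof.
move=> [aY XY] aU UY; split=> // s A FA; have [Y1 Y2] := XY s A FA.
suff -> : \int[P]_(w in A) U s w = \int[P]_(w in A) Y s w by [].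
have := UY s A FA.
rewrite in_L1_RintegralB; [|exact: FM FA|by case: aU|by case: aY].
by move/eqP; rewrite subr_eq0 => /eqP.
Qed.

(** U - Y and V - Z have the same means by the two decompositions of X, so
    [qnorm_gap] for both pairs counts them twice in the norm of X, which is
    already exhausted by Y and Z. *)
Lemma additive_decomposition_upper_envelopes X Y Z U V : adapted_L1 X ->
  (qnorm P F X < +oo)%E ->
  upper_envelope X Y -> upper_envelope (opp_process X) Z ->
  additive_decomposition P F (potential P F) X U V ->
  upper_envelope X U /\ upper_envelope (opp_process X) V.
Proof.
move=> aX qX XY XZ [[/potentialP[pU bU vU] /potentialP[pV bV vV] XUV] qE].
have aN := adapted_L1N aX.
have pY := upper_envelope_pos_supermart aX XY.
have pZ := upper_envelope_pos_supermart aN XZ.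
have [aU _ _] := pU; have [aV _ _] := pV.
have [aY _] := XY; have [aZ _] := XZ.
have [pUY pVZ] := upper_envelopes_minimal aX XY XZ pU pV XUV.
have YZ := upper_envelope_qnorm aX qX XY XZ.
have DE s : \int[P]_w diff_process U Y s w = \int[P]_w diff_process V Z s w.
  rewrite !in_L1_RintegralB//; do ?by [case: aU|case: aV|case: aY|case: aZ].
  have := decomposition_Rintegral s aX aU aV XUV measurableT.
  have := upper_envelopeB aX XY XZ (sub_sigma_setT (sF s)); lra.
have D0 s : \int[P]_w diff_process U Y s w <= 0.
  have := qnorm_gap s pU pY pUY bU vU; have := qnorm_gap s pV pZ pVZ bV vV.
  rewrite -DE; move: qX; rewrite {1}YZ; move: qE; rewrite YZ.
  have := qnorm_ge0 U; have := qnorm_ge0 V.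
  have := qnorm_ge0 Y; have := qnorm_ge0 Z.
  case: (qnorm P F U) (qnorm P F V) (qnorm P F Y) (qnorm P F Z)
    => [u| |] [v| |] [y| |] [z| |] //= _ _ _ _ + _.
  rewrite -!EFinD !lee_fin => -[]; lra.
split; [apply: upper_envelope_eq XY aU _|apply: upper_envelope_eq XZ aV _]
    => s A FA; apply: pos_supermart_mean0 => //.
by rewrite -DE.
Qed.

Lemma potential_positive_integrable_supermartingale X :
  potential P F X -> positive_integrable_supermartingale P F X.
Proof.
by move=> /potentialP[pX bX _]; apply/pos_int_supermartP.
Qed.

Lemma decomposition_norm_le X Y Z t : adapted_L1 X ->
  pos_supermart Y -> pos_supermart Z -> same_process P X (diff_process Y Z) ->
  \int[P]_w norm_process X t w <= \int[P]_w Y t w + \int[P]_w Z t w.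
Proof.
move=> [_ LX] pY pZ XYZ; have [[_ LY] _ _] := pY; have [[_ LZ] _ _] := pZ.
have LnY := norm_process_in_L1 (LY t); have LnZ := norm_process_in_L1 (LZ t).
rewrite -(pos_supermart_norm t pY) -(pos_supermart_norm t pZ).
rewrite -in_L1_RintegralD//.
apply: ae_le_Rintegral => //; [exact: norm_process_in_L1|exact: in_L1D|].
by apply: filterS (XYZ t) => w e; rewrite /norm_process e ler_normB.
Qed.

(** Finiteness of the norm of X comes from additivity. *)
Lemma decomposition_integrable_quasi_martingale X Y Z : adapted F X ->
  additive_decomposition P F (positive_integrable_supermartingale P F) X Y Z ->
  integrable_quasi_martingale P F X.
Proof.
move=> aX [[/pos_int_supermartP[pY bY]
  /pos_int_supermartP[pZ bZ] XYZ] qE].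
have [aY _ _] := pY; have [aZ _ _] := pZ.
have [aYZ LYZ] := adapted_L1B aY aZ.
have LX t : in_L1 P (X t) := same_process_in_L1 aX XYZ (LYZ t).
split; first split => //.
  by rewrite qE lte_add_pinfty//; exact: mean_bounded_qnorm.
apply/integrable_processP => //; have [C YC] := bY; have [D ZD] := bZ.
exists (C + D) => t; apply: le_trans (lerD (YC t) (ZD t)).
exact: decomposition_norm_le.
Qed.

Lemma decomposition_quasi_potential X Y Z : adapted F X ->
  additive_decomposition P F (potential P F) X Y Z -> quasi_potential P F X.
Proof.
move=> aX [[dY dZ XYZ] qE].
have [|qX _] := @decomposition_integrable_quasi_martingale X Y Z aX.
  by split=> //; split=> //;
    exact: potential_positive_integrable_supermartingale.
move: dY dZ => /potentialP[pY _ vY] /potentialP[pZ _ vZ].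
apply/quasi_potentialP; split=> // e e0; have [_ LX _] := qX.
have e20 : 0 < e / 2 by rewrite divr_gt0.
have [s sP] := vY _ e20; have [s' sP'] := vZ _ e20.
exists (Order.max s s') => t; rewrite ge_max => /andP[st st'].
have := decomposition_norm_le t (conj aX LX) pY pZ XYZ.
have := sP t st; have := sP' t st'; lra.
Qed.

Lemma integrable_quasi_martingale_envelopes X :
  integrable_quasi_martingale P F X -> exists Y Z,
  [/\ upper_envelope X Y, upper_envelope (opp_process X) Z,
      additive_decomposition P F (positive_integrable_supermartingale P F) X Y Z
    & quasi_potential P F X ->
      additive_decomposition P F (potential P F) X Y Z].
Proof.
move=> [[aX LX qX] /integrable_processP-/(_ LX) bX].
have aLX : adapted_L1 X by split.
have [Y [Z [XY XZ bY bZ]]] := upper_envelopes_exist aLX qX bX.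
have pY := upper_envelope_pos_supermart aLX XY.
have pZ := upper_envelope_pos_supermart (adapted_L1N aLX) XZ.
have XYZ := upper_envelopes_decomposition aLX XY XZ.
have qE := upper_envelope_qnorm aLX qX XY XZ.
exists Y, Z; split;
  [exact: XY|exact: XZ|split; last exact: qE|move=> /quasi_potentialP[_ vX];
   split; last exact: qE]; split; try exact: XYZ.
- exact/pos_int_supermartP.
- exact/pos_int_supermartP.
- by apply/potentialP; split=> //; exact: upper_envelope_mean_vanishing vX.
- apply/potentialP; split=> //.
  apply: (upper_envelope_mean_vanishing (adapted_L1N aLX) XZ) => e e0.
  have [s sP] := vX e e0; exists s => t st; apply: le_lt_trans (sP t st).
  by rewrite le_eqVlt; apply/orP; left; apply/eqP; apply: eq_Rintegral => w _;
    rewrite /norm_process normrN.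
Qed.

Lemma quasi_potential_integrable X :
  quasi_potential P F X -> integrable_quasi_martingale P F X.
Proof.
move=> qX; have bX := quasi_potential_mean_bounded qX.
have [qmX _] := qX; have [_ LX _] := qmX; split=> //.
exact/integrable_processP.
Qed.

Lemma upper_envelopes_minimal_supermartingales X Y Z : adapted_L1 X ->
  upper_envelope X Y -> upper_envelope (opp_process X) Z ->
  minimal_among_decompositions P (positive_integrable_supermartingale P F)
    X Y Z.
Proof.
move=> aX XY XZ U V [/pos_int_supermartP[pU bU]
  /pos_int_supermartP[pV bV] XUV].
have pY := upper_envelope_pos_supermart aX XY.
have pZ := upper_envelope_pos_supermart (adapted_L1N aX) XZ.
have [pUY pVZ] := upper_envelopes_minimal aX XY XZ pU pV XUV.
by split; apply/pos_int_supermartP; split=> //;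
  exact: mean_bounded_diff.
Qed.

Lemma upper_envelopes_minimal_potentials X Y Z : adapted_L1 X ->
  upper_envelope X Y -> upper_envelope (opp_process X) Z ->
  minimal_among_decompositions P (potential P F) X Y Z.
Proof.
move=> aX XY XZ U V [/potentialP[pU bU vU] /potentialP[pV bV vV] XUV].
have pY := upper_envelope_pos_supermart aX XY.
have pZ := upper_envelope_pos_supermart (adapted_L1N aX) XZ.
have [pUY pVZ] := upper_envelopes_minimal aX XY XZ pU pV XUV.
by split; apply/potentialP; split=> //;
  do ?[exact: mean_bounded_diff|exact: mean_vanishing_diff].
Qed.

End quasi_martingales.

Theorem corollary3 (R : realType) (dT : measure_display)
    (T : measurableType dT) (P : probability T R)
    (dD : Order.disp_t) (Delta : orderType dD) (F : Delta -> set (set T))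
    (X : Delta -> T -> R)
    (P_complete : measure_is_complete P)
    (F_filtration : filtration P F)
    (X_adapted : adapted F X) :
  ((quasi_potential P F X <->
      exists X' X'', additive_decomposition P F (potential P F) X X' X'') /\
   (forall X' X'', additive_decomposition P F (potential P F) X X' X'' ->
      minimal_among_decompositions P (potential P F) X X' X'')) /\
  ((integrable_quasi_martingale P F X <->
      exists X' X'', additive_decomposition P F
        (positive_integrable_supermartingale P F) X X' X'') /\
   (integrable_quasi_martingale P F X ->
      exists X' X'',
        additive_decomposition P F
          (positive_integrable_supermartingale P F) X X' X'' /\
        minimal_among_decompositions P
          (positive_integrable_supermartingale P F) X X' X'')).
Proof.
split; split.
- split=> [qX|[Y [Z]]]; last exact: decomposition_quasi_potential.
  have iX := quasi_potential_integrable F_filtration qX.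
  have [Y [Z [_ _ _ /(_ qX) dYZ]]] :=
    integrable_quasi_martingale_envelopes F_filtration iX.
  by exists Y, Z.
- move=> Y Z dYZ.
  have qX := decomposition_quasi_potential F_filtration X_adapted dYZ.
  have iX := quasi_potential_integrable F_filtration qX.
  have [[_ LX qy] _] := iX; have aX : adapted_L1 P F X by split.
  have [Y0 [Z0 [XY0 XZ0 _ _]]] :=
    integrable_quasi_martingale_envelopes F_filtration iX.
  have [XY XZ] := additive_decomposition_upper_envelopes F_filtration aX qy
    XY0 XZ0 dYZ.
  exact: upper_envelopes_minimal_potentials.
- split=> [iX|[Y [Z]]]; last exact: decomposition_integrable_quasi_martingale.
  have [Y [Z [_ _ dYZ _]]] :=
    integrable_quasi_martingale_envelopes F_filtration iX.
  by exists Y, Z.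
- move=> iX; have [[_ LX _] _] := iX; have aX : adapted_L1 P F X by split.
  have [Y [Z [XY XZ dYZ _]]] :=
    integrable_quasi_martingale_envelopes F_filtration iX.
  exists Y, Z; split=> //; exact: upper_envelopes_minimal_supermartingales.
Qed.
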